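(* Let $(M^n,g)$ be a compact connected Riemannian manifold without boundary and let $h$ be a smooth symmetric covariant $2$-tensor field on $M$ satisfying the Chen–Nagano gauge condition $$\delta h=-\frac12\,d(\operatorname{tr}_g h).$$ Then the linearization of the Ricci tensor at $g$ in the direction $h$ is $$(\mathrm{Ric})'(h)=\frac12\,\Delta_L h .$$ Consequently, if $g$ is an Einstein metric, then under the Chen–Nagano gauge condition the linearization at $g$ of the Ricci flow $\partial_t g=-2\,\mathrm{Ric}(g)$ takes the form of the strictly parabolic equation $$\partial_t h=-\Delta_L h .$$
   Context: All objects are smooth. $\operatorname{tr}_g h=g^{ij}h_{ij}$. The divergence of a symmetric $2$-tensor is $(\delta h)_j=-\nabla^i h_{ij}$, with $\nabla$ the Levi-Civita connection. The linearization of the Ricci tensor is $(\mathrm{Ric})'(h)=\frac{d}{ds}\big|_{s=0}\mathrm{Ric}(g+sh)$. The linearization of the Ricci flow at $g$ is the equation $\partial_t h=-2(\mathrm{Ric})'(h)$ for time-dependent symmetric $2$-tensors $h=h(t)$, with $(\mathrm{Ric})'$ computed at the fixed metric $g$; ''under the Chen–Nagano gauge condition'' means that $h(t)$ satisfies $\delta h=-\frac12 d(\operatorname{tr}_g h)$ at each time. The rough Laplacian is $\nabla^*\nabla h=-\operatorname{tr}_g(\nabla^2 h)$. The Lichnerowicz Laplacian on symmetric $2$-tensors is $$\Delta_L h=\nabla^*\nabla h-2\mathring{R}(h)+\mathrm{Ric}\circ h+h\circ\mathrm{Ric},\qquad (\mathring{R}(h))_{ij}=R_{ikjl}h^{kl},$$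 with the curvature sign convention for which $g^{kl}R_{ikjl}=\mathrm{Ric}_{ij}$ (so $\mathring R(g)=\mathrm{Ric}$). *)

(* Defs.v *)
From HB Require Import structures.
From mathcomp Require Import all_boot all_order all_algebra.
From mathcomp Require Import all_classical all_reals all_analysis.

Set Implicit Arguments.
Unset Strict Implicit.
Unset Printing Implicit Defensive.

Import Order.TTheory GRing.Theory Num.Theory.
Import numFieldNormedType.Exports.

Local Open Scope classical_set_scope.
Local Open Scope ring_scope.

(* Riemannian geometry in local coordinates over the library's normed space
   'rV[R]_n: manifolds are given by an atlas, and a tensor field is the family
   of its component functions in the charts of the atlas, subject to the
   transformation law on overlaps. *)

Section Smoothness.
Variables (R : realType) (n : nat).
Implicit Types (f : 'rV[R]_n -> R) (U : set 'rV[R]_n).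

Definition partial (i : 'I_n) f : 'rV[R]_n -> R :=
  fun x => 'D_('e_i) f x.

(* C^k on U; only meant for open U, as the derivatives are two-sided. *)
Fixpoint Ck_on (k : nat) U f : Prop :=
  (forall x, U x -> {for x, continuous f}) /\
  if k is k'.+1 then
    forall i : 'I_n, (forall x, U x -> derivable f x 'e_i) /\
                     Ck_on k' U (partial i f)
  else True.

Definition smooth_on U f : Prop := forall k, Ck_on k U f.

End Smoothness.

Record chart (R : realType) (n : nat) (T : topologicalType) := Chart {
  chart_dom : set T;
  chart_img : set 'rV[R]_n;
  chart_map : T -> 'rV[R]_n;
  chart_inv : 'rV[R]_n -> T;
  chart_dom_open : open chart_dom;
  chart_img_open : open chart_img;
  chart_map_img : forall p, chart_dom p -> chart_img (chart_map p);
  chart_inv_dom : forall x, chart_img x -> chart_dom (chart_inv x);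
  chart_mapK : forall p, chart_dom p -> chart_inv (chart_map p) = p;
  chart_invK : forall x, chart_img x -> chart_map (chart_inv x) = x;
  chart_map_continuous :
    forall p, chart_dom p -> {for p, continuous chart_map};
  chart_inv_continuous :
    forall x, chart_img x -> {for x, continuous chart_inv} }.

Section Transition.
Variables (R : realType) (n : nat) (T : topologicalType).
Variables (c d : chart R n T).

Definition overlap : set 'rV[R]_n :=
  [set x | chart_img c x /\ chart_dom d (chart_inv c x)].

Definition transition (x : 'rV[R]_n) : 'rV[R]_n :=
  chart_map d (chart_inv c x).

End Transition.

(* Smooth n-manifold without boundary.  The atlas is not required to be
   maximal: any atlas determines the smooth structure, and a tensor field is
   determined by its components in the charts of any atlas. *)
Record manifold (R : realType) (n : nat) (T : topologicalType) := Manifold {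
  chart_index : Type;
  atlas : chart_index -> chart R n T;
  manifold_hausdorff : hausdorff_space T;
  manifold_second_countable : @second_countable T;
  atlas_cover : forall p : T, exists a, chart_dom (atlas a) p;
  atlas_compat : forall (a b : chart_index) (k : 'I_n),
    smooth_on (overlap (atlas a) (atlas b))
      (fun x => transition (atlas a) (atlas b) x ord0 k) }.

Section LocalGeometry.
Variables (R : realType) (n : nat).
Variable g : 'rV[R]_n -> 'M[R]_n.
Implicit Types (h : 'rV[R]_n -> 'M[R]_n) (x : 'rV[R]_n) (i j k l : 'I_n).

Definition gup x : 'M[R]_n := invmx (g x).

(* christoffel k i j x is Gamma^k_{ij}(x) for the Levi-Civita connection. *)
Definition christoffel k i j x : R :=
  2^-1 * \sum_(l < n) gup x k l *
    (partial i (fun y => g y j l) x + partial j (fun y => g y i l) x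
     - partial l (fun y => g y i j) x).

(* nabla h k i j = nabla_k h_{ij} *)
Definition nabla h k i j x : R :=
  partial k (fun y => h y i j) x
  - \sum_(a < n) christoffel a k i x * h x a j
  - \sum_(a < n) christoffel a k j x * h x i a.

(* nabla2 h k l i j = (nabla^2 h)(d_k, d_l; d_i, d_j) = nabla_k nabla_l h_{ij} *)
Definition nabla2 h k l i j x : R :=
  partial k (nabla h l i j) x
  - \sum_(a < n) christoffel a k l x * nabla h a i j x
  - \sum_(a < n) christoffel a k i x * nabla h l a j x
  - \sum_(a < n) christoffel a k j x * nabla h l i a x.

Definition trace_g h x : R := \sum_(i < n) \sum_(j < n) gup x i j * h x i j.

Definition delta_g h j x : R :=
  - \sum_(i < n) \sum_(k < n) gup x i k * nabla h k i j x.

(* R(d_a, d_b) d_c = \sum_d riemann a b c d * d_d, where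
   R(X, Y) Z = nabla_X nabla_Y Z - nabla_Y nabla_X Z - nabla_[X, Y] Z. *)
Definition riemann (a b c d : 'I_n) x : R :=
  partial a (christoffel d b c) x - partial b (christoffel d a c) x
  + \sum_(e < n) (christoffel d a e x * christoffel e b c x
                  - christoffel d b e x * christoffel e a c x).

(* riemann_low i k j l = R_{ikjl} = g(R(d_k, d_i) d_j, d_l), which has
   g^{kl} R_{ikjl} = Ric_{ij}; on the unit sphere it is
   g_{ij} g_{kl} - g_{il} g_{kj}. *)
Definition riemann_low i k j l x : R :=
  \sum_(d < n) g x l d * riemann k i j d x.

(* Ric(Y, Z) = trace of X |-> R(X, Y) Z *)
Definition ricci x : 'M[R]_n := \matrix_(i, j) \sum_(k < n) riemann k i j k x.

Definition rough_laplacian h x : 'M[R]_n :=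
  \matrix_(i, j) - \sum_(k < n) \sum_(l < n) gup x k l * nabla2 h k l i j x.

(* h^{kl} is the (k, l) entry of gup *m h *m gup. *)
Definition Rring h x : 'M[R]_n :=
  \matrix_(i, j) \sum_(k < n) \sum_(l < n)
    riemann_low i k j l x * (gup x *m h x *m gup x) k l.

(* The composition of 2-tensors (s o h)_{ij} = g^{kl} s_{ik} h_{lj} is
   s *m gup *m h. *)
Definition lichnerowicz h x : 'M[R]_n :=
  rough_laplacian h x - 2 *: Rring h x
  + ricci x *m gup x *m h x + h x *m gup x *m ricci x.

Definition covector_sqnorm x (xi : 'rV[R]_n) : R :=
  (xi *m gup x *m xi^T) ord0 ord0.

(* <eta, zeta> = g^{ik} g^{jl} eta_{ij} zeta_{kl} *)
Definition tensor_inner x (eta zeta : 'M[R]_n) : R :=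
  \sum_(i < n) \sum_(j < n) (gup x *m eta *m gup x) i j * zeta i j.

End LocalGeometry.

(* (Ric)'(h) at x; at a fixed point x and for small s, g + s h is again
   positive definite near x. *)
Definition ricci_lin (R : realType) (n : nat) (g h : 'rV[R]_n -> 'M[R]_n)
    (x : 'rV[R]_n) : 'M[R]_n :=
  derive1 (fun s : R => ricci (fun y => g y + s *: h y) x) 0.

Section TensorFields.
Variables (R : realType) (n : nat) (T : topologicalType).
Variable M : manifold R n T.

Definition tensor_field := chart_index M -> 'rV[R]_n -> 'M[R]_n.

(* Values of the components at points x outside the image of the chart are
   irrelevant.  The library's jacobian acts on row vectors, so its (i, k) entry
   is the derivative of the k-th new coordinate along the i-th old one, and the
   law reads h_{ij} = d_i y^k d_j y^l h'_{kl}. *)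
Definition sym2_tensor (h : tensor_field) : Prop :=
  [/\ forall a i j, smooth_on (chart_img (atlas a)) (fun x => h a x i j),
      forall a x, chart_img (atlas a) x -> (h a x)^T = h a x
    & forall a b x, overlap (atlas a) (atlas b) x ->
        let J := jacobian (transition (atlas a) (atlas b)) x in
        h a x = J *m h b (transition (atlas a) (atlas b) x) *m J^T].

Definition riemannian_metric (g : tensor_field) : Prop :=
  sym2_tensor g /\
  forall a x, chart_img (atlas a) x ->
    forall v : 'rV[R]_n, v != 0 -> 0 < (v *m g a x *m v^T) ord0 ord0.

Definition einstein (g : tensor_field) : Prop :=
  exists lam : R, forall a x, chart_img (atlas a) x ->
    ricci (g a) x = lam *: g a x.

Definition chen_nagano (g h : tensor_field) : Prop :=
  forall a x, chart_img (atlas a) x -> forall j : 'I_n,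
    delta_g (g a) (h a) j x = - (2^-1 * partial j (trace_g (g a) (h a)) x).

(* d_t h = L h on the time interval J, with one-sided derivatives at the
   endpoints of J that belong to J. *)
Definition evolves_by (L : tensor_field -> tensor_field) (J : interval R)
    (h : R -> tensor_field) : Prop :=
  forall t, t \in J -> forall a x, chart_img (atlas a) x ->
    (fun s => (s - t)^-1 *: (h s a x - h t a x)) @ within [set` J] t^'
      --> L (h t) a x.

(* The equation d_t h = L h on symmetric 2-tensors is strictly parabolic: L is
   a linear differential operator of second order whose principal symbol
   sigma(x, xi) satisfies
   <sigma(x, xi) eta, eta> >= c |xi|^2 |eta|^2 for some constant c > 0.
   A, B and C are the coefficients of L in the charts. *)
Definition strictly_parabolic (g : tensor_field)
    (L : tensor_field -> tensor_field) : Prop :=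
  exists (A : chart_index M ->
              'I_n -> 'I_n -> 'I_n -> 'I_n -> 'I_n -> 'I_n -> 'rV[R]_n -> R)
         (B : chart_index M ->
              'I_n -> 'I_n -> 'I_n -> 'I_n -> 'I_n -> 'rV[R]_n -> R)
         (C : chart_index M ->
              'I_n -> 'I_n -> 'I_n -> 'I_n -> 'rV[R]_n -> R),
  [/\ forall a i j k l,
        [/\ forall p q, smooth_on (chart_img (atlas a)) (A a i j k l p q),
            forall p, smooth_on (chart_img (atlas a)) (B a i j k l p)
          & smooth_on (chart_img (atlas a)) (C a i j k l)],
      forall h, sym2_tensor h -> forall a x, chart_img (atlas a) x ->
        forall i j, L h a x i j =
          \sum_(k < n) \sum_(l < n)
            (\sum_(p < n) \sum_(q < n) A a i j k l p q x *
               partial p (partial q (fun y => h a y k l)) x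
             + \sum_(p < n) B a i j k l p x * partial p (fun y => h a y k l) x
             + C a i j k l x * h a x k l)
    & exists2 c : R, 0 < c &
        forall a x, chart_img (atlas a) x ->
        forall (xi : 'rV[R]_n) (eta : 'M[R]_n), eta^T = eta ->
          let sigma : 'M[R]_n := \matrix_(i, j)
            \sum_(k < n) \sum_(l < n) \sum_(p < n) \sum_(q < n)
              A a i j k l p q x * xi ord0 p * xi ord0 q * eta k l in
          c * covector_sqnorm (g a) x xi * tensor_inner (g a) x eta eta
            <= tensor_inner (g a) x sigma eta].

End TensorFields.

(* Main.v *)
Require Import Defs.
From HB Require Import structures.
From mathcomp Require Import all_boot all_order all_algebra.
From mathcomp Require Import all_classical all_reals all_analysis.
From mathcomp Require Import ring lra.
Import Order.TTheory GRing.Theory Num.Theory.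
Import numFieldNormedType.Exports.
Local Open Scope classical_set_scope.
Local Open Scope ring_scope.
Set Implicit Arguments.
Unset Strict Implicit.
Unset Printing Implicit Defensive.

(** The statement is local: both sides of each claim are computed in one chart,
    so everything below happens on an open set [U] of row vectors carrying
    a smooth field [g] of symmetric invertible matrices.

    Put g_s = g + s h and let nabla be the connection of g.  Two Levi-Civita
    connections differ by a tensor ([christoffel_change]), and since
    nabla g = 0 this difference is, without any remainder, s times
    D_s^k_ij = 1/2 g_s^{kl} (nabla_i h_jl + nabla_j h_il - nabla_l h_ij)
    ([christoffel_pert]).  Therefore Ric(g_s) = Ric(g) + s Q_s, where Q_s is a
    polynomial in s, D_s, the first derivatives of D_s and the Christoffel
    symbols of g ([ricci_pert]).  Since Q_s is continuous at s = 0, the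
    derivative of Ric(g_s) at 0 exists and equals Q_0 ([is_derive_ricci]);
    derivatives in s are never interchanged with derivatives in the
    coordinates.

    Metric compatibility turns Q_0 into
    1/2 (g^{kl} (nabla_k nabla_i h_jl + nabla_k nabla_j h_il
                 - nabla_k nabla_l h_ij) - nabla_i nabla_j (tr h))
    ([dricciE]).  The third term is the rough Laplacian.  In the first two the
    derivatives are commuted by the Ricci identity; the curvature terms of the
    contraction are exactly the zeroth order part of the Lichnerowicz Laplacian,
    and what is left over is - nabla_i (delta h)_j
    ([contracted_ricci_identity]).  Under the gauge condition this is
    1/2 nabla_i nabla_j (tr h), and the two copies cancel the Hessian of the
    trace ([dricci_lichnerowicz]).

    For the parabolicity, - Delta_L h_ij is g^{pq} d_p d_q h_ij plus terms of
    order at most one ([lichnerowicz_symbol]), so that its principal symbol at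
    a covector xi is multiplication by |xi|^2, and the constant 1 works. *)

(** Reification of a goal whose atoms are large sums is dominated by the
    comparison of those atoms up to conversion; replacing them by variables
    first makes the comparison syntactic. *)
Ltac generalize_atoms :=
  repeat match goal with
  | |- context [@bigop.body ?R ?I ?z ?r ?F] => generalize (@bigop.body R I z r F)
  end;
  repeat match goal with
  | |- context [@partial ?R ?n ?i ?f ?x] => generalize (@partial R n i f x)
  | |- context [@nabla2 ?R ?n ?g ?h ?k ?l ?i ?j ?x] =>
      generalize (@nabla2 R n g h k l i j x)
  | |- context [@nabla ?R ?n ?g ?h ?k ?i ?j ?x] =>
      generalize (@nabla R n g h k i j x)
  | |- context [@riemann ?R ?n ?g ?a ?b ?c ?d ?x] =>
      generalize (@riemann R n g a b c d x)
  | |- context [@riemann_low ?R ?n ?g ?a ?b ?c ?d ?x] =>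
      generalize (@riemann_low R n g a b c d x)
  | |- context [@christoffel ?R ?n ?g ?a ?b ?c ?x] =>
      generalize (@christoffel R n g a b c x)
  | |- context [@fun_of_matrix ?R ?m ?n ?A ?i ?j] =>
      generalize (@fun_of_matrix R m n A i j)
  end; intros.

Ltac ring_atoms := generalize_atoms; ring.

(** * Calculus of functions with continuous iterated partial derivatives *)

Section Smooth.
Variables (R : realType) (n : nat) (U : set 'rV[R]_n).
Hypothesis oU : open U.
Implicit Types (f : 'rV[R]_n -> R) (x : 'rV[R]_n) (i j : 'I_n).

Let nearU x : U x -> \forall y \near x, U y.
Proof. by move=> Ux; exact: open_nbhs_nbhs. Qed.

(** Partial derivatives at a point only depend on the germ, and [U] is open. *)
Lemma eq_partial i f f' x : U x -> (forall y, U y -> f y = f' y) ->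
  partial i f x = partial i f' x.
Proof.
move=> Ux ff'; apply: near_eq_derive.
by apply: filterS (nearU Ux) => y; exact: ff'.
Qed.

Lemma eq_derivable i f f' x : U x -> (forall y, U y -> f y = f' y) ->
  derivable f x 'e_i -> derivable f' x 'e_i.
Proof.
move=> Ux ff'; apply: near_eq_derivable.
by apply: filterS (nearU Ux) => y; exact: ff'.
Qed.

Lemma eq_continuous_at f f' x : U x -> (forall y, U y -> f y = f' y) ->
  {for x, continuous f} -> {for x, continuous f'}.
Proof.
move=> Ux ff'; rewrite /prop_for /continuous_at -(ff' x Ux).
have /near_eq_cvg H : \forall y \near x, f y = f' y.
  by apply: filterS (nearU Ux) => y; exact: ff'.
by move=> cf; apply: cvg_trans cf; exact: H.
Qed.

Lemma eq_Ck k f f' : (forall y, U y -> f y = f' y) ->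
  Ck_on k U f -> Ck_on k U f'.
Proof.
elim: k f f' => [|k IH] f f' ff' [cf df]; split.
- by move=> x Ux; apply: eq_continuous_at ff' _ => //; exact: cf.
- by [].
- by move=> x Ux; apply: eq_continuous_at ff' _ => //; exact: cf.
- move=> i; have [dfi Cfi] := df i; split.
    by move=> x Ux; apply: eq_derivable ff' _ => //; exact: dfi.
  by apply: IH Cfi => y Uy; exact: eq_partial.
Qed.

Lemma Ck_pred k f : Ck_on k.+1 U f -> Ck_on k U f.
Proof.
elim: k f => [|k IH] f [cf df]; split => // i.
by have [dfi /IH Cfi] := df i.
Qed.

Lemma Ck_cst k (c : R) : Ck_on k U (fun=> c).
Proof.
elim: k c => [|k IH] c; split => //.
- by move=> x _; exact: cst_continuous.
- by move=> x _; exact: cst_continuous.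
move=> i; split; first by move=> x _; exact: derivable_cst.
by apply: (eq_Ck _ (IH 0)) => y Uy; rewrite /partial derive_cst.
Qed.

Lemma Ck_add k f f' : Ck_on k U f -> Ck_on k U f' ->
  Ck_on k U (fun x => f x + f' x).
Proof.
elim: k f f' => [|k IH] f f' [cf df] [cf' df']; split => //.
- by move=> x Ux; exact: (continuousD (cf x Ux) (cf' x Ux)).
- by move=> x Ux; exact: (continuousD (cf x Ux) (cf' x Ux)).
- move=> i; have [dfi Cfi] := df i; have [dfi' Cfi'] := df' i; split.
    by move=> x Ux; apply: derivableD; [exact: dfi|exact: dfi'].
  apply: (eq_Ck _ (IH _ _ Cfi Cfi')) => y Uy.
  by rewrite /partial -deriveD; [|exact: dfi|exact: dfi'].
Qed.

(** By induction on the order: the Leibniz rule writes the partial derivative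
    of a product with factors that are one order less smooth. *)
Lemma Ck_mul k f f' : Ck_on k U f -> Ck_on k U f' ->
  Ck_on k U (fun x => f x * f' x).
Proof.
elim: k f f' => [|k IH] f f' Cf Cf'; have [cf df] := Cf; have [cf' df'] := Cf';
  split => //.
- by move=> x Ux; exact: (continuousM (cf x Ux) (cf' x Ux)).
- by move=> x Ux; exact: (continuousM (cf x Ux) (cf' x Ux)).
- move=> i; have [dfi Cfi] := df i; have [dfi' Cfi'] := df' i; split.
    by move=> x Ux; apply: derivableM; [exact: dfi|exact: dfi'].
  apply: (eq_Ck _ (Ck_add (IH _ _ (Ck_pred Cf) Cfi') (IH _ _ (Ck_pred Cf') Cfi))).
  move=> y Uy; rewrite /partial.
  by rewrite -[fun x => f x * f' x]/(f * f') deriveM; [|exact: dfi|exact: dfi'].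
Qed.

(** By induction on the order, from d(1/f) = - f^-2 df. *)
Lemma Ck_inv k f : (forall x, U x -> f x != 0) -> Ck_on k U f ->
  Ck_on k U (fun x => (f x)^-1).
Proof.
move=> f0; elim: k f f0 => [|k IH] f f0 Cf; have [cf df] := Cf; split => //.
- by move=> x Ux; exact: (continuousV (f0 x Ux) (cf x Ux)).
- by move=> x Ux; exact: (continuousV (f0 x Ux) (cf x Ux)).
- move=> i; have [dfi Cfi] := df i; split.
    by move=> x Ux; apply: derivableV; [exact: f0|exact: dfi].
  have CV := IH _ f0 (Ck_pred Cf).
  apply: (eq_Ck _ (Ck_mul (Ck_mul (Ck_cst k (-1)) (Ck_mul CV CV)) Cfi)).
  move=> y Uy; rewrite /partial.
  have -> := @deriveV _ _ f y 'e_i (f0 y Uy) (dfi y Uy).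
  by rewrite /GRing.scale /= -invfM -expr2; ring.
Qed.

Lemma eq_smooth f f' : (forall y, U y -> f y = f' y) ->
  smooth_on U f -> smooth_on U f'.
Proof. by move=> ff' sf k; exact: eq_Ck (sf k). Qed.

Lemma smooth_cst (c : R) : smooth_on U (fun=> c).
Proof. by move=> k; exact: Ck_cst. Qed.

Lemma smooth_add f f' : smooth_on U f -> smooth_on U f' ->
  smooth_on U (fun x => f x + f' x).
Proof. by move=> sf sf' k; exact: Ck_add. Qed.

Lemma smooth_mul f f' : smooth_on U f -> smooth_on U f' ->
  smooth_on U (fun x => f x * f' x).
Proof. by move=> sf sf' k; exact: Ck_mul. Qed.

Lemma smooth_opp f : smooth_on U f -> smooth_on U (fun x => - f x).
Proof.
move=> sf; apply: (eq_smooth _ (smooth_mul (smooth_cst (-1)) sf)) => y _.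
by rewrite mulN1r.
Qed.

Lemma smooth_sub f f' : smooth_on U f -> smooth_on U f' ->
  smooth_on U (fun x => f x - f' x).
Proof. by move=> sf sf'; apply: smooth_add sf (smooth_opp sf'). Qed.

Lemma smooth_inv f : (forall x, U x -> f x != 0) -> smooth_on U f ->
  smooth_on U (fun x => (f x)^-1).
Proof. by move=> f0 sf k; exact: Ck_inv. Qed.

Lemma smooth_sum (I : Type) (r : seq I) (P : pred I) (F : I -> 'rV[R]_n -> R) :
  (forall a, smooth_on U (F a)) ->
  smooth_on U (fun x => \sum_(a <- r | P a) F a x).
Proof.
move=> sF; elim: r => [|a r IH].
  by apply: eq_smooth (smooth_cst 0) => y _; rewrite big_nil.
have [Pa|Pa] := boolP (P a).
  by apply: eq_smooth (smooth_add (sF a) IH) => y _; rewrite big_cons Pa.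
by apply: eq_smooth IH => y _; rewrite big_cons (negbTE Pa).
Qed.

Lemma smooth_prod (I : Type) (r : seq I) (P : pred I) (F : I -> 'rV[R]_n -> R) :
  (forall a, smooth_on U (F a)) ->
  smooth_on U (fun x => \prod_(a <- r | P a) F a x).
Proof.
move=> sF; elim: r => [|a r IH].
  by apply: eq_smooth (smooth_cst 1) => y _; rewrite big_nil.
have [Pa|Pa] := boolP (P a).
  by apply: eq_smooth (smooth_mul (sF a) IH) => y _; rewrite big_cons Pa.
by apply: eq_smooth IH => y _; rewrite big_cons (negbTE Pa).
Qed.

Lemma smooth_partial i f : smooth_on U f -> smooth_on U (partial i f).
Proof. by move=> sf k; have [_ /(_ i) []] := sf k.+1. Qed.

Lemma smooth_derivable i f x : smooth_on U f -> U x -> derivable f x 'e_i.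
Proof. by move=> sf Ux; have [_ /(_ i) [df _]] := sf 1%N; exact: df. Qed.

Lemma smooth_continuous f x : smooth_on U f -> U x -> {for x, continuous f}.
Proof. by move=> sf Ux; have [cf _] := sf 0%N; exact: cf. Qed.

Lemma smooth_det m (A : 'rV[R]_n -> 'M[R]_m) :
  (forall i j : 'I_m, smooth_on U (fun x => A x i j)) ->
  smooth_on U (fun x => \det (A x)).
Proof.
move=> sA; apply: smooth_sum => s; apply: smooth_mul; first exact: smooth_cst.
exact: smooth_prod.
Qed.

(** Cramer's rule: the entries of the inverse are polynomials in the entries
    of the matrix divided by the determinant. *)
Lemma smooth_invmx m (A : 'rV[R]_n -> 'M[R]_m) :
  (forall x, U x -> A x \in unitmx) ->
  (forall i j : 'I_m, smooth_on U (fun x => A x i j)) ->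
  forall i j : 'I_m, smooth_on U (fun x => invmx (A x) i j).
Proof.
move=> uA sA i j.
apply: (@eq_smooth (fun x => (\det (A x))^-1 *
  ((-1) ^+ (j + i) * \det (row' j (col' i (A x)))))).
  by move=> y Uy; rewrite /invmx uA // !mxE.
apply: smooth_mul.
  apply: smooth_inv; last exact: smooth_det.
  by move=> x Ux; rewrite -unitfE -unitmxE uA.
apply: smooth_mul; first exact: smooth_cst.
apply: smooth_det => i' j'.
by apply: (eq_smooth _ (sA (lift j i') (lift i j'))) => y _; rewrite !mxE.
Qed.

Lemma partialD i f f' x : smooth_on U f -> smooth_on U f' -> U x ->
  partial i (fun y => f y + f' y) x = partial i f x + partial i f' x.
Proof.
by move=> sf sf' Ux; apply: deriveD; apply: smooth_derivable.
Qed.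

Lemma partialM i f f' x : smooth_on U f -> smooth_on U f' -> U x ->
  partial i (fun y => f y * f' y) x
  = partial i f x * f' x + f x * partial i f' x.
Proof.
move=> sf sf' Ux; rewrite /partial -[fun y => _]/(f * f') deriveM;
  try exact: smooth_derivable.
by rewrite addrC /GRing.scale /= mulrC; congr (_ + _); rewrite mulrC.
Qed.

Lemma partial_cst i (c : R) x : partial i (fun=> c) x = 0.
Proof. exact: derive_cst. Qed.

Lemma partialZ i (c : R) f x : smooth_on U f -> U x ->
  partial i (fun y => c * f y) x = c * partial i f x.
Proof.
move=> sf Ux; rewrite (partialM _ (smooth_cst c) sf) // partial_cst.
by rewrite mul0r add0r.
Qed.

Lemma partialN i f x : smooth_on U f -> U x ->
  partial i (fun y => - f y) x = - partial i f x.
Proof.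
move=> sf Ux; rewrite -mulN1r -partialZ //; apply: eq_partial => // y _.
by rewrite mulN1r.
Qed.

Lemma partialB i f f' x : smooth_on U f -> smooth_on U f' -> U x ->
  partial i (fun y => f y - f' y) x = partial i f x - partial i f' x.
Proof.
by move=> sf sf' Ux; rewrite partialD // ?partialN //; exact: smooth_opp.
Qed.

Lemma partial_sum i (I : Type) (r : seq I) (F : I -> 'rV[R]_n -> R) x :
  (forall a, smooth_on U (F a)) -> U x ->
  partial i (fun y => \sum_(a <- r) F a y) x = \sum_(a <- r) partial i (F a) x.
Proof.
move=> sF Ux; elim: r => [|a r IH].
  rewrite big_nil -[RHS](partial_cst i 0 x).
  by apply: eq_partial => // y _; rewrite big_nil.
rewrite big_cons -IH -partialD //; last exact: smooth_sum.
by apply: eq_partial => // y _; rewrite big_cons.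
Qed.

End Smooth.

Lemma smooth_subset (R : realType) (n : nat) (U V : set 'rV[R]_n) f :
  V `<=` U -> smooth_on U f -> smooth_on V f.
Proof.
move=> VU sf k; move: (sf k) => {sf}; elim: k f => [|k IH] f [cf df]; split => //.
- by move=> x /VU; exact: cf.
- by move=> x /VU; exact: cf.
- move=> i; have [dfi Cfi] := df i; split; last exact: IH.
  by move=> x /VU; exact: dfi.
Qed.

(** * Symmetry of second partial derivatives *)

Section Schwarz.
Variables (R : realType) (n : nat) (U : set 'rV[R]_n).
Hypothesis oU : open U.
Implicit Types (f : 'rV[R]_n -> R) (x : 'rV[R]_n) (i j : 'I_n).

(** Restricting to a line turns a partial derivative into the derivative of
    a function of one real variable, to which the mean value theorem applies. *)
Lemma is_derive_line i f (z : 'rV[R]_n) (s : R) :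
  derivable f (s *: 'e_i + z) 'e_i ->
  is_derive s 1 (fun r : R => f (r *: 'e_i + z)) (partial i f (s *: 'e_i + z)).
Proof.
have E : (fun h : R => h^-1 *: (f ((h *: (1 : R) + s) *: 'e_i + z) -
             f (s *: 'e_i + z)))
  = (fun h : R => h^-1 *: (f (h *: 'e_i + (s *: 'e_i + z)) - f (s *: 'e_i + z))).
  apply: funext => h; rewrite scalerDl addrA; congr (_ *: (f (_ + _ + _) - _)).
  by rewrite /GRing.scale /= mulr1.
move=> df; split.
  by rewrite /derivable /= E.
by rewrite /partial /derive /= E.
Qed.

(** Two applications of the mean value theorem, first along 'e_i to the
    difference of [f] between the two sides of the square, then along 'e_j. *)
Lemma second_difference i j f x (t : R) : smooth_on U f -> 0 < t ->
  (forall a b, 0 <= a <= t -> 0 <= b <= t -> U (a *: 'e_i + b *: 'e_j + x)) ->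
  exists a b, [/\ 0 <= a <= t, 0 <= b <= t &
    f (t *: 'e_i + t *: 'e_j + x) - f (t *: 'e_i + x) - f (t *: 'e_j + x) + f x
    = t ^+ 2 * partial j (partial i f) (a *: 'e_i + b *: 'e_j + x)].
Proof.
move=> sf t0 Ut.
have tt : 0 <= t <= t by rewrite ltW /=.
have t00 : 0 <= (0 : R) <= t by rewrite lexx ltW.
have D1 b s : 0 <= b <= t -> 0 <= s <= t ->
    is_derive s 1 (fun r : R => f (r *: 'e_i + (b *: 'e_j + x)))
                  (partial i f (s *: 'e_i + (b *: 'e_j + x))).
  move=> hb hs; apply: is_derive_line; apply: smooth_derivable sf _ => //.
  by rewrite addrA; exact: Ut.
have D2 a s : 0 <= a <= t -> 0 <= s <= t ->
    is_derive s 1 (fun r : R => partial i f (r *: 'e_j + (a *: 'e_i + x)))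
                  (partial j (partial i f) (s *: 'e_j + (a *: 'e_i + x))).
  move=> ha hs; apply: is_derive_line.
  apply: smooth_derivable (smooth_partial i sf) _ => //.
  by rewrite addrCA addrA; exact: Ut.
have oo_cc s : s \in `]0, t[ -> 0 <= s <= t.
  by rewrite in_itv /= => /andP[/ltW -> /ltW ->].
pose F r := f (r *: 'e_i + (t *: 'e_j + x)) - f (r *: 'e_i + (0 *: 'e_j + x)).
have DF s : 0 <= s <= t -> is_derive s 1 F
    (partial i f (s *: 'e_i + (t *: 'e_j + x))
     - partial i f (s *: 'e_i + (0 *: 'e_j + x))).
  by move=> hs; apply: is_deriveB; exact: D1.
have [] := @MVT_segment R F _ 0 t (ltW t0) (fun s hs => DF s (oo_cc s hs)).
- apply: derivable_within_continuous => s; rewrite in_itv /= => hs.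
  by have [] := DF s hs.
move=> a; rewrite in_itv /= => ha; rewrite subr0 => E1.
have [] := @MVT_segment R _ _ 0 t (ltW t0) (fun s hs => D2 a s ha (oo_cc s hs)).
- apply: derivable_within_continuous => s; rewrite in_itv /= => hs.
  by have [] := D2 a s ha hs.
move=> b; rewrite in_itv /= => hb; rewrite subr0 => E2.
exists a, b; split => //.
have swap u v : u *: 'e_i + (v *: 'e_j + x) = v *: 'e_j + (u *: 'e_i + x).
  exact: addrCA.
move: E1; rewrite /F !swap E2 !scale0r !add0r => E1.
by rewrite -!addrA !swap mulrC expr2 mulrA -E1; ring.
Qed.

(** The second difference over a square of side t equals t^2 times a mixed
    derivative in either order, each taken at some point of the square; letting
    the square shrink, continuity identifies the two at [x]. *)
Lemma schwarz i j f x : smooth_on U f -> U x ->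
  partial i (partial j f) x = partial j (partial i f) x.
Proof.
move=> sf Ux; apply/eqP; rewrite -subr_eq0 -normr_le0; apply/ler_addgt0Pl => e e0.
rewrite addr0.
have cont p q : {for x, continuous (partial p (partial q f))}.
  by apply: smooth_continuous Ux; do 2 apply: smooth_partial.
have e20 : 0 < e / 2 by rewrite divr_gt0.
have near_x p q : nbhs x [set y |
    `|partial p (partial q f) x - partial p (partial q f) y| <= e / 2].
  by have /cvgrPdist_le /(_ _ e20) := cont p q.
have nU : nbhs x U by exact: open_nbhs_nbhs.
have [r r0 Hr] : exists2 r : R, 0 < r & forall y, `|y - x| < r -> [/\ U y,
    `|partial i (partial j f) x - partial i (partial j f) y| <= e / 2 &
    `|partial j (partial i f) x - partial j (partial i f) y| <= e / 2].
  have : nbhs x (U `&` ([set y |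
      `|partial i (partial j f) x - partial i (partial j f) y| <= e / 2] `&`
    [set y |
      `|partial j (partial i f) x - partial j (partial i f) y| <= e / 2])).
    apply: filterI; first exact: nU.
    by apply: filterI; exact: near_x.
  move=> /nbhs_ballP[r /= r0 Hr]; exists r => // y yx.
  have : ball x r y by rewrite -ball_normE /= distrC.
  by move/Hr => -[Uy [Ey Ey2]]; split; [exact: Uy|exact: Ey|exact: Ey2].
(* The side t of the square is so small that the square stays in the ball of
   radius r, because a |e_i| + b |e_j| < t N for a, b <= t. *)
pose N := `|'e_i : 'rV[R]_n| + `|'e_j : 'rV[R]_n| + 1.
have N0 : 0 < N by rewrite ltr_wpDl // addr_ge0.
pose t := r / 2 / N.
have t0 : 0 < t by rewrite !divr_gt0.
have close p q (a b : R) : `|'e_p : 'rV[R]_n| + `|'e_q : 'rV[R]_n| + 1 = N ->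
    0 <= a <= t -> 0 <= b <= t ->
    `|(a *: 'e_p + b *: 'e_q + x) - x| < r.
  move=> EN /andP[a0 at_] /andP[b0 bt]; rewrite addrK.
  apply: le_lt_trans (ler_normD _ _) _; rewrite !normrZ !ger0_norm //.
  apply: (@le_lt_trans _ _ (t * N)).
    rewrite -EN !mulrDr mulr1 -[leLHS]addr0.
    by rewrite !lerD ?ler_wpM2r // ltW.
  by rewrite /t divfK ?gt_eqF // ltr_pdivrMr // ltr_pMr // ltr1n.
have [a [b [ha hb E1]]] := @second_difference i j f x t sf t0
  (fun a b ha hb => let: And3 h _ _ := Hr _ (@close i j a b erefl ha hb) in h).
have EN : `|'e_j : 'rV[R]_n| + `|'e_i : 'rV[R]_n| + 1 = N.
  by rewrite /N (addrC `|'e_j|).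
have [a' [b' [ha' hb' E2]]] := @second_difference j i f x t sf t0
  (fun a b ha hb => let: And3 h _ _ := Hr _ (@close j i a b EN ha hb) in h).
have [_ _ B1] := Hr _ (close i j a b erefl ha hb).
have [_ B2 _] := Hr _ (close j i a' b' EN ha' hb').
have E : partial j (partial i f) (a *: 'e_i + b *: 'e_j + x)
       = partial i (partial j f) (a' *: 'e_j + b' *: 'e_i + x).
  apply: (@mulfI _ (t ^+ 2)); first by rewrite expf_neq0 // gt_eqF.
  apply: (etrans (esym E1)).
  apply: (etrans _ E2).
  rewrite (addrC (t *: 'e_j) (t *: 'e_i)).
  congr (_ + _).
  exact: addrAC.
rewrite E in B1.
move: B1 B2; move: (partial i (partial j f) (_ + _ + _)) => w.
move=> B1 B2; rewrite [e]splitr.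
move: (partial j (partial i f) x) (partial i (partial j f) x) B1 B2 => u v B1 B2.
apply: le_trans (lerD B2 B1).
by rewrite (distrC u w); exact: ler_distD.
Qed.

End Schwarz.

(** * Levi-Civita connection of a local metric *)

Definition smooth_field (R : realType) (n : nat) (U : set 'rV[R]_n)
    (h : 'rV[R]_n -> 'M[R]_n) : Prop :=
  forall i j, smooth_on U (fun x => h x i j).

Definition symmetric_field (R : realType) (n : nat) (U : set 'rV[R]_n)
    (h : 'rV[R]_n -> 'M[R]_n) : Prop :=
  forall x, U x -> (h x)^T = h x.

Record local_metric (R : realType) (n : nat) (U : set 'rV[R]_n)
    (g : 'rV[R]_n -> 'M[R]_n) : Prop := LocalMetric {
  metric_open : open U;
  metric_smooth : smooth_field U g;
  metric_symmetric : symmetric_field U g;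
  metric_unit : forall x, U x -> g x \in unitmx }.

Section Metric.
Variables (R : realType) (n : nat) (U : set 'rV[R]_n).
Variable g : 'rV[R]_n -> 'M[R]_n.
Hypothesis gm : local_metric U g.

Let oU : open U := metric_open gm.
Let gs : smooth_field U g := metric_smooth gm.
Let gsym : symmetric_field U g := metric_symmetric gm.
Let gu : forall x, U x -> g x \in unitmx := metric_unit gm.
Implicit Types (x : 'rV[R]_n) (i j k l a b c d e : 'I_n).

Local Notation "'Gam'" := (christoffel g).

Lemma sum_deltal k (F : 'I_n -> R) : \sum_(a < n) (k == a)%:R * F a = F k.
Proof.
rewrite (bigD1 k) //= eqxx mul1r big1 ?addr0 // => a /negbTE ak.
by rewrite eq_sym ak mul0r.
Qed.

Lemma sum_deltar k (F : 'I_n -> R) : \sum_(a < n) F a * (a == k)%:R = F k.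
Proof.
by rewrite -[RHS]sum_deltal; apply: eq_bigr => a _; rewrite mulrC eq_sym.
Qed.

Lemma metricC x i j : U x -> g x i j = g x j i.
Proof. by move=> Ux; rewrite -[in LHS]gsym // mxE. Qed.

Lemma gupC x i j : U x -> gup g x i j = gup g x j i.
Proof. by move=> Ux; rewrite /gup -[in LHS]gsym // -trmx_inv mxE. Qed.

Lemma gup_metric x k j : U x -> \sum_(l < n) gup g x k l * g x l j = (k == j)%:R.
Proof.
by move=> Ux; have := mulVmx (gu Ux); move/matrixP/(_ k j); rewrite !mxE.
Qed.

Lemma metric_gup x k j : U x -> \sum_(l < n) g x k l * gup g x l j = (k == j)%:R.
Proof.
by move=> Ux; have := mulmxV (gu Ux); move/matrixP/(_ k j); rewrite !mxE.
Qed.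

Lemma partial_metricC x k i j : U x ->
  partial k (fun y => g y i j) x = partial k (fun y => g y j i) x.
Proof. by move=> Ux; apply: (eq_partial oU) => // y Uy; exact: metricC. Qed.

Lemma smooth_gup i j : smooth_on U (fun x => gup g x i j).
Proof. exact: smooth_invmx. Qed.

Lemma smooth_christoffel k i j : smooth_on U (Gam k i j).
Proof.
apply: smooth_mul => //; first exact: smooth_cst.
apply: smooth_sum => // l; apply: smooth_mul => //; first exact: smooth_gup.
by apply: smooth_sub => //; first apply: smooth_add => //;
  exact: smooth_partial.
Qed.

Lemma christoffelC k i j x : U x -> Gam k i j x = Gam k j i x.
Proof.
move=> Ux; congr (_ * _); apply: eq_bigr => l _; congr (_ * _).
by rewrite (partial_metricC _ i j) // [X in X - _]addrC.
Qed.

(** Lowering the upper index undoes the multiplication by the inverse metric. *)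
Lemma christoffel_low l i j x : U x ->
  \sum_(k < n) g x l k * Gam k i j x =
  2^-1 * (partial i (fun y => g y j l) x + partial j (fun y => g y i l) x
    - partial l (fun y => g y i j) x).
Proof.
move=> Ux; set T := fun l => partial i (fun y => g y j l) x +
  partial j (fun y => g y i l) x - partial l (fun y => g y i j) x.
transitivity (\sum_(k < n) \sum_(m < n) g x l k * gup g x k m * (2^-1 * T m)).
  apply: eq_bigr => k _; rewrite /christoffel mulrCA !mulr_sumr.
  by apply: eq_bigr => m _; rewrite -/(T m); ring.
rewrite exchange_big /=.
under eq_bigr do rewrite -mulr_suml metric_gup //.
by rewrite sum_deltal.
Qed.

(** Metric compatibility of the Levi-Civita connection. *)
Lemma nabla_metric k i j x : U x -> nabla g g k i j x = 0.
Proof.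
move=> Ux; rewrite /nabla.
have -> : \sum_(a < n) Gam a k i x * g x a j = \sum_(a < n) g x j a * Gam a k i x.
  by apply: eq_bigr => a _; rewrite metricC // mulrC.
have -> : \sum_(a < n) Gam a k j x * g x i a = \sum_(a < n) g x i a * Gam a k j x.
  by apply: eq_bigr => a _; rewrite mulrC.
rewrite !christoffel_low // (partial_metricC _ j i) // (partial_metricC _ k j) //.
by field.
Qed.

(** Differentiate gup * g = 1. *)
Lemma partial_gup k a b x : U x ->
  partial k (fun y => gup g y a b) x =
  - \sum_(c < n) \sum_(d < n)
      gup g x a c * partial k (fun y => g y c d) x * gup g x d b.
Proof.
move=> Ux.
have D0 d : \sum_(c < n) (partial k (fun y => gup g y a c) x * g x c d +
              gup g x a c * partial k (fun y => g y c d) x) = 0.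
  rewrite -[RHS](partial_cst k (a == d)%:R x).
  transitivity (partial k (fun y => \sum_(c < n) gup g y a c * g y c d) x).
    rewrite (partial_sum oU) // => [|c].
      by apply: eq_bigr => c _; rewrite (partialM _ (smooth_gup a c) (gs c d) Ux).
    by apply: (smooth_mul oU) => //; exact: smooth_gup.
  by apply: (eq_partial oU) => // y Uy; rewrite gup_metric.
have {}D0 d : \sum_(c < n) partial k (fun y => gup g y a c) x * g x c d =
   - \sum_(c < n) gup g x a c * partial k (fun y => g y c d) x.
  by apply/eqP; rewrite -subr_eq0 opprK -big_split D0.
rewrite -[LHS](sum_deltar b (fun c => partial k (fun y => gup g y a c) x)).
under eq_bigr do rewrite -(metric_gup _ _ Ux) mulr_sumr.
rewrite exchange_big /=.
under eq_bigr do (under eq_bigr do rewrite mulrA; rewrite -mulr_suml D0).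
rewrite [in RHS]exchange_big -sumrN; apply: eq_bigr => d _ /=.
by rewrite mulNr mulr_suml.
Qed.

Lemma partial_metric k i j x : U x -> partial k (fun y => g y i j) x =
  \sum_(a < n) Gam a k i x * g x a j + \sum_(a < n) Gam a k j x * g x i a.
Proof.
move=> Ux; have := nabla_metric k i j Ux; rewrite /nabla => /eqP.
by rewrite -addrA -opprD subr_eq0 => /eqP.
Qed.

(** The inverse metric is parallel as well: insert [partial_metric] in the
    derivative of the inverse. *)
Lemma partial_gup_christoffel k a b x : U x ->
  partial k (fun y => gup g y a b) x =
  - \sum_(c < n) Gam a k c x * gup g x c b
  - \sum_(c < n) Gam b k c x * gup g x a c.
Proof.
move=> Ux; rewrite partial_gup //.
under eq_bigr do under eq_bigr do rewrite partial_metric // mulrDr mulrDl.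
under eq_bigr do rewrite big_split /=.
rewrite big_split /= opprD addrC; congr (_ + _); congr (- _).
  transitivity (\sum_(d < n) \sum_(e < n) Gam e k d x *
      (\sum_(c < n) gup g x a c * g x c e) * gup g x d b).
    rewrite exchange_big; apply: eq_bigr => d _ /=.
    under eq_bigr do rewrite mulr_sumr mulr_suml.
    rewrite exchange_big; apply: eq_bigr => e _ /=.
    by rewrite mulr_sumr mulr_suml; apply: eq_bigr => c _; ring.
  apply: eq_bigr => d _; rewrite -mulr_suml; congr (_ * _).
  by under eq_bigr do rewrite gup_metric // eq_sym; rewrite sum_deltar.
transitivity (\sum_(c < n) \sum_(e < n) gup g x a c * Gam e k c x *
    (\sum_(d < n) g x e d * gup g x d b)).
  apply: eq_bigr => c _; under eq_bigr do rewrite mulr_sumr mulr_suml.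
  rewrite exchange_big; apply: eq_bigr => e _ /=.
  by rewrite mulr_sumr; apply: eq_bigr => d _; ring.
apply: eq_bigr => c _; under eq_bigr do rewrite metric_gup //.
by rewrite sum_deltar mulrC.
Qed.

End Metric.

(** * Ricci identity and symmetries of the curvature *)

Section Curvature.
Variables (R : realType) (n : nat) (U : set 'rV[R]_n).
Variable g : 'rV[R]_n -> 'M[R]_n.
Hypothesis gm : local_metric U g.
Implicit Types (x : 'rV[R]_n) (i j k l a b c d e : 'I_n).

Let oU : open U := metric_open gm.
Local Notation "'Gam'" := (christoffel g).

Lemma smooth_nabla h k i j : smooth_field U h ->
  smooth_on U (nabla g h k i j).
Proof.
move=> hs; apply: smooth_sub => //; first apply: smooth_sub => //.
- exact: smooth_partial.
- by apply: smooth_sum => // a; apply: smooth_mul => //;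
    exact: smooth_christoffel.
- by apply: smooth_sum => // a; apply: smooth_mul => //;
    exact: smooth_christoffel.
Qed.

Lemma symmetric_fieldC h x i j : symmetric_field U h -> U x -> h x i j = h x j i.
Proof. by move=> hsym Ux; rewrite -[in LHS]hsym // mxE. Qed.

Lemma nabla_sym h k i j x : symmetric_field U h -> U x ->
  nabla g h k i j x = nabla g h k j i x.
Proof.
move=> hsym Ux; rewrite /nabla (@eq_partial _ _ _ oU _ _ (fun y => h y j i)) //;
  last by move=> y Uy; exact: symmetric_fieldC.
rewrite -!addrA; congr (_ + _); rewrite addrC.
by congr (- _ - _); apply: eq_bigr => a _; rewrite (@symmetric_fieldC h).
Qed.

Lemma partial_nabla h k l i j x : smooth_field U h -> U x ->
  partial k (nabla g h l i j) x =
    partial k (partial l (fun y => h y i j)) x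
    - (\sum_(a < n) partial k (Gam a l i) x * h x a j
      + \sum_(a < n) Gam a l i x * partial k (fun y => h y a j) x)
    - (\sum_(a < n) partial k (Gam a l j) x * h x i a
      + \sum_(a < n) Gam a l j x * partial k (fun y => h y i a) x).
Proof.
move=> hs Ux.
have sG a p q : smooth_on U (Gam a p q) by exact: smooth_christoffel.
have sGh a p q b c : smooth_on U (fun y => Gam a p q y * h y b c).
  exact: smooth_mul.
rewrite /nabla (partialB oU) //; last by apply: smooth_sum.
  rewrite (partialB oU) //; last by apply: smooth_sum.
    rewrite !(partial_sum oU) // -!big_split /=.
    by congr (_ - _ - _); apply: eq_bigr => a _;
      rewrite (partialM _ (sG _ _ _) (hs _ _)).
  exact: smooth_partial.
by apply: smooth_sub => //; [exact: smooth_partial|exact: smooth_sum].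
Qed.

(** Exchanging [k] and [l] permutes all terms except the derivatives of the
    Christoffel symbols and the products of two Christoffel symbols contracted
    with each other; these exceptions make up the curvature. *)
Lemma nabla2E h k l i j x : smooth_field U h -> U x ->
  nabla2 g h k l i j x =
    partial k (partial l (fun y => h y i j)) x
    - \sum_(a < n) partial k (Gam a l i) x * h x a j
    - \sum_(a < n) Gam a l i x * partial k (fun y => h y a j) x
    - \sum_(a < n) partial k (Gam a l j) x * h x i a
    - \sum_(a < n) Gam a l j x * partial k (fun y => h y i a) x
    - \sum_(a < n) Gam a k l x * nabla g h a i j x
    - \sum_(a < n) Gam a k i x * partial l (fun y => h y a j) x
    + \sum_(e < n) \sum_(a < n) Gam e l a x * Gam a k i x * h x e j
    + \sum_(a < n) \sum_(b < n) Gam a k i x * Gam b l j x * h x a b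
    - \sum_(a < n) Gam a k j x * partial l (fun y => h y i a) x
    + \sum_(a < n) \sum_(b < n) Gam a l i x * Gam b k j x * h x a b
    + \sum_(e < n) \sum_(a < n) Gam e l a x * Gam a k j x * h x i e.
Proof.
move=> hs Ux.
have D1 := partial_nabla k l i j hs Ux.
have D2 : \sum_(a < n) Gam a k i x * nabla g h l a j x =
    \sum_(a < n) Gam a k i x * partial l (fun y => h y a j) x
    - \sum_(e < n) \sum_(a < n) Gam e l a x * Gam a k i x * h x e j
    - \sum_(a < n) \sum_(b < n) Gam a k i x * Gam b l j x * h x a b.
  rewrite [X in _ - X - _]exchange_big /= -!sumrB; apply: eq_bigr => a _.
  rewrite [nabla _ _ _ _ _ _]/nabla 2!mulrBr 2!mulr_sumr.
  by congr (_ - _ - _); apply: eq_bigr => b _; ring_atoms.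
have D3 : \sum_(a < n) Gam a k j x * nabla g h l i a x =
    \sum_(a < n) Gam a k j x * partial l (fun y => h y i a) x
    - \sum_(a < n) \sum_(b < n) Gam a l i x * Gam b k j x * h x a b
    - \sum_(e < n) \sum_(a < n) Gam e l a x * Gam a k j x * h x i e.
  rewrite [X in _ - X - _]exchange_big [X in _ - _ - X]exchange_big /=.
  rewrite -!sumrB; apply: eq_bigr => a _.
  rewrite [nabla _ _ _ _ _ _]/nabla 2!mulrBr 2!mulr_sumr.
  by congr (_ - _ - _); apply: eq_bigr => b _; ring_atoms.
by rewrite /nabla2 D1 D2 D3; ring_atoms.
Qed.

Lemma riemann_sum k l i (F : 'I_n -> R) x :
  \sum_(e < n) riemann g k l i e x * F e =
  \sum_(e < n) partial k (Gam e l i) x * F e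
  - \sum_(e < n) partial l (Gam e k i) x * F e
  + \sum_(e < n) \sum_(a < n) Gam e k a x * Gam a l i x * F e
  - \sum_(e < n) \sum_(a < n) Gam e l a x * Gam a k i x * F e.
Proof.
rewrite -sumrB -big_split -sumrB; apply: eq_bigr => e _ /=.
rewrite /riemann !mulrDl mulNr -[RHS]addrA; congr (_ + _).
by rewrite sumrB mulrBl !mulr_suml.
Qed.

(** In [nabla2E] the second partial derivatives of [h] cancel by [schwarz], the
    first order terms cancel in pairs, and the term with the Christoffel symbol
    in [k] and [l] cancels because the connection is torsion free. *)
Lemma ricci_identity h k l i j x : smooth_field U h -> U x ->
  nabla2 g h k l i j x - nabla2 g h l k i j x =
  - \sum_(e < n) riemann g k l i e x * h x e j
  - \sum_(e < n) riemann g k l j e x * h x i e.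
Proof.
move=> hs Ux; rewrite !nabla2E // !riemann_sum (schwarz oU k l (hs i j)) //.
have -> : \sum_(a < n) Gam a k l x * nabla g h a i j x
    = \sum_(a < n) Gam a l k x * nabla g h a i j x.
  by apply: eq_bigr => a _; rewrite (christoffelC gm).
ring_atoms.
Qed.

Lemma riemann_anti a b c d x : riemann g a b c d x = - riemann g b a c d x.
Proof.
rewrite /riemann opprD opprB -sumrN; congr (_ + _).
by apply: eq_bigr => e _; ring_atoms.
Qed.

(** The connection is torsion free. *)
Lemma riemann_bianchi a b c d x : U x ->
  riemann g a b c d x + riemann g b c a d x + riemann g c a b d x = 0.
Proof.
move=> Ux; rewrite /riemann.
have pC k p q r : partial p (Gam k q r) x = partial p (Gam k r q) x.
  by apply: (eq_partial oU) => // y Uy; rewrite (christoffelC gm).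
rewrite (pC d b a c) (pC d a b c) (pC d c a b).
have C := christoffelC gm _ _ _ Ux.
set S1 := \sum_(e < n) _; set S2 := \sum_(e < n) _; set S3 := \sum_(e < n) _.
suff H : S1 + S2 + S3 = 0 by rewrite -[RHS]H; ring_atoms.
rewrite /S1 /S2 /S3 -!big_split big1 // => e _ /=.
rewrite (C e c b) (C e a c) (C e b a); ring_atoms.
Qed.

Lemma riemann_low_anti12 i k j l x :
  riemann_low g i k j l x = - riemann_low g k i j l x.
Proof.
rewrite /riemann_low -sumrN; apply: eq_bigr => d _.
by rewrite riemann_anti mulrN.
Qed.

Lemma nabla2_metric k l i j x : U x -> nabla2 g g k l i j x = 0.
Proof.
move=> Ux; rewrite /nabla2.
rewrite (@eq_partial _ _ _ oU _ _ (fun=> 0)) //; last first.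
  by move=> y Uy; exact: (nabla_metric gm).
rewrite partial_cst !big1 ?subr0 // => a _;
  by rewrite (nabla_metric gm) // mulr0.
Qed.

(** The Ricci identity applied to the parallel tensor [g]. *)
Lemma riemann_low_anti34 i k j l x : U x ->
  riemann_low g i k j l x = - riemann_low g i k l j x.
Proof.
move=> Ux; have := ricci_identity k i j l (metric_smooth gm) Ux.
rewrite !nabla2_metric // subrr => /esym /eqP; rewrite -opprD oppr_eq0.
rewrite addr_eq0 => /eqP E; rewrite /riemann_low.
transitivity (\sum_(e < n) riemann g k i j e x * g x e l).
  by apply: eq_bigr => e _; rewrite (metricC gm l e) // mulrC.
by rewrite E; congr (- _); apply: eq_bigr => e _; rewrite mulrC.
Qed.

Lemma riemann_low_bianchi i k j l x : U x ->
  riemann_low g i k j l x + riemann_low g j i k l x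
  + riemann_low g k j i l x = 0.
Proof.
move=> Ux; rewrite /riemann_low -!big_split big1 // => d _ /=.
by rewrite -!mulrDr riemann_bianchi // mulr0.
Qed.

(** The Bianchi identities for the four cyclic rearrangements of the indices,
    combined with the two antisymmetries, leave twice the claim. *)
Lemma riemann_low_pair i k j l x : U x ->
  riemann_low g i k j l x = riemann_low g j l i k x.
Proof.
move=> Ux; have B a b c d := riemann_low_bianchi a b c d Ux.
have A a b c d := riemann_low_anti34 a b c d Ux.
have B1 := B i k j l; have B2 := B k j l i.
have B3 := B j l i k; have B4 := B l i k j.
move: B1 B2 B3 B4.
rewrite (A k j l i) (A j l k i) (A i k l j) (A l i k j).
rewrite (A k l i j) (riemann_low_anti12 k l j i) opprK.
rewrite (riemann_low_anti12 i j l k) (A j i l k) opprK.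
generalize_atoms; lra.
Qed.

Lemma riemannE k i j d x : U x ->
  riemann g k i j d x = \sum_(l < n) gup g x d l * riemann_low g i k j l x.
Proof.
move=> Ux; rewrite /riemann_low.
under eq_bigr do rewrite mulr_sumr.
rewrite exchange_big /=.
under eq_bigr => e _.
  under eq_bigr do rewrite mulrA.
  rewrite -mulr_suml (gup_metric gm) //; over.
by rewrite sum_deltal.
Qed.

Lemma ricciE i j x : U x -> ricci g x i j =
  \sum_(k < n) \sum_(l < n) gup g x k l * riemann_low g i k j l x.
Proof.
by move=> Ux; rewrite mxE; apply: eq_bigr => k _; exact: riemannE.
Qed.

Lemma ricci_sym i j x : U x -> ricci g x i j = ricci g x j i.
Proof.
move=> Ux; rewrite (ricciE i j Ux) (ricciE j i Ux) [RHS]exchange_big.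
apply: eq_bigr => k _; apply: eq_bigr => l _.
by rewrite (gupC gm k l Ux) (riemann_low_pair _ _ _ _ Ux).
Qed.

End Curvature.

(** * Contractions of covariant derivatives *)

Section Contraction.
Variables (R : realType) (n : nat) (U : set 'rV[R]_n).
Variable g : 'rV[R]_n -> 'M[R]_n.
Hypothesis gm : local_metric U g.
Variable h : 'rV[R]_n -> 'M[R]_n.
Hypothesis hs : smooth_field U h.
Hypothesis hsym : symmetric_field U h.
Implicit Types (x : 'rV[R]_n) (i j k l a b c d e : 'I_n).

Let oU : open U := metric_open gm.
Local Notation "'Gam'" := (christoffel g).
Let sG a p q : smooth_on U (Gam a p q) := smooth_christoffel gm a p q.
Let sP i j : smooth_on U (fun x => gup g x i j) := smooth_gup gm i j.
Let sN k i j : smooth_on U (nabla g h k i j) := smooth_nabla gm k i j hs.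

(** Raising an index commutes with covariant differentiation; only the index
    [l] and the raised index [c] are differentiated covariantly. *)
Lemma partial_raise k c (S : 'I_n -> 'rV[R]_n -> R) x :
  (forall l, smooth_on U (S l)) -> U x ->
  partial k (fun y => \sum_(l < n) gup g y c l * S l y) x
  = \sum_(l < n) gup g x c l * (partial k (S l) x - \sum_(a < n) Gam a k l x * S a x)
    - \sum_(a < n) Gam c k a x * \sum_(l < n) gup g x a l * S l x.
Proof.
move=> sS Ux; rewrite (partial_sum oU) //; last first.
  by move=> l; exact: smooth_mul.
under eq_bigr do rewrite (partialM _ (sP _ _) (sS _)) //.
under eq_bigr do rewrite (partial_gup_christoffel gm) //.
under [in RHS]eq_bigr do rewrite mulrBr.
rewrite big_split sumrB /= addrC -addrA; congr (_ + _).
under eq_bigr do rewrite mulrBl mulNr.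
rewrite sumrB sumrN addrC.
by congr (- _ - _); under [LHS]eq_bigr do rewrite mulr_suml;
  rewrite exchange_big; apply: eq_bigr => l _ /=;
  rewrite mulr_sumr; apply: eq_bigr => a _; ring_atoms.
Qed.

(** A contraction with the inverse metric is differentiated covariantly in the
    two contracted indices, all others being inert. *)
Lemma partial_contract k (T : 'I_n -> 'I_n -> 'rV[R]_n -> R) x :
  (forall p q, smooth_on U (T p q)) -> U x ->
  partial k (fun y => \sum_(p < n) \sum_(q < n) gup g y p q * T p q y) x
  = \sum_(p < n) \sum_(q < n) gup g x p q * (partial k (T p q) x
      - \sum_(a < n) Gam a k p x * T a q x - \sum_(a < n) Gam a k q x * T p a x).
Proof.
move=> sT Ux; rewrite (partial_sum oU) //; last first.
  by move=> p; apply: smooth_sum => // q; exact: smooth_mul.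
under [LHS]eq_bigr do rewrite partial_raise //.
rewrite sumrB.
have -> : \sum_(p < n) \sum_(a < n) Gam p k a x * (\sum_(l < n) gup g x a l * T p l x)
    = \sum_(p < n) \sum_(q < n) gup g x p q * (\sum_(a < n) Gam a k p x * T a q x).
  rewrite exchange_big; apply: eq_bigr => p _ /=.
  under [LHS]eq_bigr do rewrite mulr_sumr; rewrite exchange_big; apply: eq_bigr => q _.
  by rewrite mulr_sumr; apply: eq_bigr => a _ /=; ring_atoms.
rewrite -sumrB; apply: eq_bigr => p _; rewrite -sumrB; apply: eq_bigr => q _.
by ring_atoms.
Qed.

Lemma smooth_trace : smooth_on U (trace_g g h).
Proof.
by apply: smooth_sum => // i; apply: smooth_sum => // j; exact: smooth_mul.
Qed.

Lemma partial_trace j x : U x -> partial j (trace_g g h) x =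
  \sum_(k < n) \sum_(l < n) gup g x k l * nabla g h j k l x.
Proof. by move=> Ux; rewrite partial_contract. Qed.

Lemma delta_gE j x : U x ->
  delta_g g h j x = - \sum_(k < n) \sum_(l < n) gup g x k l * nabla g h k j l x.
Proof.
move=> Ux; congr (- _); rewrite exchange_big; apply: eq_bigr => k _.
apply: eq_bigr => l _ /=; rewrite (gupC gm) //.
by rewrite (nabla_sym gm).
Qed.

Lemma nabla_delta i j x : U x ->
  \sum_(k < n) \sum_(l < n) gup g x k l * nabla2 g h i k j l x =
  - (partial i (delta_g g h j) x - \sum_(a < n) Gam a i j x * delta_g g h a x).
Proof.
move=> Ux; have sW b : smooth_on U
    (fun y => \sum_(k < n) \sum_(l < n) gup g y k l * nabla g h k b l y).
  by apply: smooth_sum => // k; apply: smooth_sum => // l; exact: smooth_mul.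
rewrite (eq_partial oU _ Ux (@delta_gE j)) (partialN oU) //.
rewrite (@partial_contract _ (fun k l => nabla g h k j l)) //.
have -> : \sum_(a < n) Gam a i j x * delta_g g h a x =
    - \sum_(k < n) \sum_(l < n) gup g x k l *
        (\sum_(a < n) Gam a i j x * nabla g h k a l x).
  under [LHS]eq_bigr do rewrite delta_gE // mulrN mulr_sumr.
  rewrite sumrN; congr (- _).
  rewrite exchange_big; apply: eq_bigr => k _ /=.
  under [LHS]eq_bigr do rewrite mulr_sumr; rewrite exchange_big; apply: eq_bigr => l _.
  by rewrite mulr_sumr; apply: eq_bigr => a _ /=; ring_atoms.
rewrite opprB opprK addrC -sumrB.
apply: eq_bigr => k _; rewrite -sumrB; apply: eq_bigr => l _.
by rewrite /nabla2; ring_atoms.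
Qed.

Lemma RringE i j x : U x -> Rring g h x i j =
  \sum_(k < n) \sum_(l < n) gup g x k l * \sum_(e < n) riemann g k i j e x * h x e l.
Proof.
move=> Ux; rewrite mxE; apply: eq_bigr => k _.
transitivity (\sum_(e < n) riemann g k i j e x * (gup g x *m h x) k e).
  under [LHS]eq_bigr do rewrite /riemann_low mulr_suml; rewrite exchange_big /=.
  apply: eq_bigr => e _.
  have hE : gup g x *m h x = (gup g x *m h x *m gup g x) *m g x.
    by rewrite -[RHS]mulmxA (mulVmx (metric_unit gm Ux)) mulmx1.
  rewrite [in RHS]hE [in RHS]mxE mulr_sumr; apply: eq_bigr => l _.
  by rewrite (metricC gm l e Ux) -mulrA mulrCA [X in _ * X]mulrC.
under [RHS]eq_bigr do rewrite mulr_sumr; rewrite [RHS]exchange_big /=.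
apply: eq_bigr => e _; rewrite mxE mulr_sumr; apply: eq_bigr => l _.
by rewrite (symmetric_fieldC l e hsym Ux) mulrCA.
Qed.

Lemma Rring_sym i j x : U x -> Rring g h x i j = Rring g h x j i.
Proof.
move=> Ux; have Hsym k l : (gup g x *m h x *m gup g x) k l =
    (gup g x *m h x *m gup g x) l k.
  have Psym : (gup g x)^T = gup g x.
    by apply/matrixP => p q; rewrite mxE (gupC gm).
  have Hs : (gup g x *m h x *m gup g x)^T = gup g x *m h x *m gup g x.
    by rewrite !trmx_mul Psym hsym // mulmxA.
  by rewrite -[in RHS]Hs [RHS]mxE.
rewrite [LHS]mxE [RHS]mxE exchange_big.
apply: eq_bigr => l _; apply: eq_bigr => k _ /=.
by rewrite (riemann_low_pair gm) // Hsym.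
Qed.

Lemma ricci_comp i j x : U x -> (ricci g x *m gup g x *m h x) i j =
  - \sum_(k < n) \sum_(l < n) gup g x k l *
      \sum_(e < n) riemann g k i l e x * h x j e.
Proof.
move=> Ux.
have RP e : (ricci g x *m gup g x) i e =
    - \sum_(k < n) \sum_(l < n) gup g x k l * riemann g k i l e x.
  rewrite mxE -sumrN.
  transitivity (\sum_(m < n) \sum_(k < n) \sum_(l < n)
      gup g x k l * riemann_low g i k m l x * gup g x m e).
    apply: eq_bigr => m _; rewrite (ricciE gm) // mulr_suml.
    by apply: eq_bigr => k _; rewrite mulr_suml.
  rewrite exchange_big; apply: eq_bigr => k _ /=.
  rewrite exchange_big -sumrN; apply: eq_bigr => l _ /=.
  rewrite (riemannE gm) // mulr_sumr -sumrN; apply: eq_bigr => m _.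
  by rewrite (riemann_low_anti34 gm i k m l) // (gupC gm m e) //; ring_atoms.
rewrite mxE.
under eq_bigr do rewrite RP mulNr mulr_suml.
rewrite sumrN; congr (- _); rewrite exchange_big; apply: eq_bigr => k _ /=.
under eq_bigr do rewrite mulr_suml; rewrite exchange_big; apply: eq_bigr => l _ /=.
rewrite mulr_sumr; apply: eq_bigr => e _.
by rewrite (symmetric_fieldC e j hsym Ux) -mulrA.
Qed.

(** The Ricci identity produces two curvature terms: contracted with the
    inverse metric, the one acting on [j] becomes the curvature operator on
    [h], and the one acting on the contracted index becomes the Ricci tensor
    composed with [h]. *)
Lemma contracted_ricci_identity i j x : U x ->
  \sum_(k < n) \sum_(l < n) gup g x k l * nabla2 g h k i j l x =
  - (partial i (delta_g g h j) x - \sum_(a < n) Gam a i j x * delta_g g h a x)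
  - Rring g h x i j + (ricci g x *m gup g x *m h x) i j.
Proof.
move=> Ux; rewrite -nabla_delta // RringE // ricci_comp // -!sumrB.
apply: eq_bigr => k _; rewrite -!sumrB; apply: eq_bigr => l _.
have := ricci_identity gm k i j l hs Ux => /eqP; rewrite subr_eq => /eqP ->.
ring_atoms.
Qed.

End Contraction.

(** * Limits of inverse matrices and change of metric *)

Section ContinuousMatrix.
Variables (R : realType) (T : Type) (F : set_system T).
Hypothesis FF : Filter F.

Lemma cvg_det m (A : T -> 'M[R]_m) (A0 : 'M[R]_m) :
  (forall i j, A t i j @[t --> F] --> A0 i j) ->
  \det (A t) @[t --> F] --> \det A0.
Proof.
move=> cA; apply: cvg_big => [|s _]; first exact: add_continuous.
apply: cvgM; first exact: cvg_cst.
by apply: cvg_big => [|i _]; [exact: mul_continuous|exact: cA].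
Qed.

(** The cofactor formula is continuous wherever the determinant is nonzero,
    which holds eventually since determinants are continuous. *)
Lemma cvg_invmx m (A : T -> 'M[R]_m) (A0 : 'M[R]_m) : A0 \in unitmx ->
  (forall i j, A t i j @[t --> F] --> A0 i j) ->
  forall i j, invmx (A t) i j @[t --> F] --> invmx A0 i j.
Proof.
move=> uA cA i j.
have dA0 : \det A0 != 0 by rewrite -unitfE -unitmxE.
have E (B : 'M[R]_m) : \det B != 0 -> (\det B)^-1 *
    ((-1) ^+ (j + i) * \det (row' j (col' i B))) = invmx B i j.
  by move=> dB; rewrite /invmx unitmxE unitfE dB !mxE.
rewrite -(E _ dA0).
have nE : \forall t \near F, (\det (A t))^-1 *
    ((-1) ^+ (j + i) * \det (row' j (col' i (A t)))) = invmx (A t) i j.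
  have nd : \forall t \near F, \det (A t) != 0.
    exact: cvgr_neq0 (cvg_det cA) dA0.
  by apply: filterS nd => t; exact: E.
apply: cvg_trans (near_eq_cvg nE) _.
apply: cvgM; first by apply: cvgV => //; exact: cvg_det.
apply: cvgM; first exact: cvg_cst.
apply: cvg_det => i' j'; rewrite !mxE.
have -> : (fun t => (row' j (col' i (A t))) i' j') =
    (fun t => A t (lift j i') (lift i j')) by apply: funext => t; rewrite !mxE.
exact: cA.
Qed.

End ContinuousMatrix.

(** The Koszul formula for [g'] with partial derivatives replaced by the
    covariant derivatives of another torsion free connection: its Christoffel
    symbols cancel except for one contraction of [g'] with its inverse. *)
Lemma christoffel_change (R : realType) (n : nat) (U V : set 'rV[R]_n)
    (g g' : 'rV[R]_n -> 'M[R]_n) k i j x :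
  local_metric U g -> local_metric V g' -> U x -> V x ->
  christoffel g' k i j x = christoffel g k i j x +
    2^-1 * \sum_(l < n) gup g' x k l *
      (nabla g g' i j l x + nabla g g' j i l x - nabla g g' l i j x).
Proof.
move=> gm gm' Ux Vx.
have C := christoffelC gm _ _ _ Ux; have G := metricC gm' _ _ Vx.
have dC a p q := partial_metricC gm' a p q Vx.
have E l : nabla g g' i j l x + nabla g g' j i l x - nabla g g' l i j x =
    (partial i (fun y => g' y j l) x + partial j (fun y => g' y i l) x
      - partial l (fun y => g' y i j) x)
    - 2 * \sum_(a < n) christoffel g a i j x * g' x a l.
  rewrite /nabla.
  have -> : \sum_(a < n) christoffel g a j i x * g' x a l =
      \sum_(a < n) christoffel g a i j x * g' x a l.
    by apply: eq_bigr => a _; rewrite (C a j i).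
  have -> : \sum_(a < n) christoffel g a l i x * g' x a j =
      \sum_(a < n) christoffel g a i l x * g' x j a.
    by apply: eq_bigr => a _; rewrite (C a l i) (G a j).
  have -> : \sum_(a < n) christoffel g a l j x * g' x i a =
      \sum_(a < n) christoffel g a j l x * g' x i a.
    by apply: eq_bigr => a _; rewrite (C a l j).
  by ring_atoms.
under [X in _ = _ + _ * X]eq_bigr do rewrite E mulrBr.
rewrite sumrB mulrBr -[LHS]/(2^-1 * _).
have -> : \sum_(l < n) gup g' x k l *
    (2 * \sum_(a < n) christoffel g a i j x * g' x a l)
    = 2 * christoffel g k i j x.
  transitivity (\sum_(a < n) 2 * christoffel g a i j x *
      \sum_(l < n) gup g' x k l * g' x l a).
    under [LHS]eq_bigr do rewrite !mulr_sumr.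
    rewrite exchange_big; apply: eq_bigr => a _ /=; rewrite mulr_sumr.
    by apply: eq_bigr => l _; rewrite (G a l); ring_atoms.
  under eq_bigr do rewrite (gup_metric gm' _ _ Vx) eq_sym.
  by rewrite sum_deltar.
by rewrite mulrA mulVf ?pnatr_eq0 // mul1r addrC subrK.
Qed.

(** * Ricci curvature along the line g + s h *)

Section Variation.
Variables (R : realType) (n : nat) (U : set 'rV[R]_n).
Variables g h : 'rV[R]_n -> 'M[R]_n.
Hypothesis gm : local_metric U g.
Hypothesis hs : smooth_field U h.
Hypothesis hsym : symmetric_field U h.
Implicit Types (x : 'rV[R]_n) (s : R) (i j k l a b c d e : 'I_n).

Let oU : open U := metric_open gm.
Local Notation "'Gam'" := (christoffel g).
Let sG a p q : smooth_on U (Gam a p q) := smooth_christoffel gm a p q.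
Let sN k i j : smooth_on U (nabla g h k i j) := smooth_nabla gm k i j hs.

Definition pert s : 'rV[R]_n -> 'M[R]_n := fun y => g y + s *: h y.

Definition pert_dom s : set 'rV[R]_n := U `&` [set y | pert s y \in unitmx].

(** Twice the first variation of the Christoffel symbols, with the upper index
    lowered. *)
Definition dchristoffel_low i j l x : R :=
  nabla g h i j l x + nabla g h j i l x - nabla g h l i j x.

(** The inverse of the perturbed metric, not of [g], makes this the exact
    difference quotient of the Christoffel symbols along the line g + s h. *)
Definition dchristoffel s k i j x : R :=
  2^-1 * \sum_(l < n) gup (pert s) x k l * dchristoffel_low i j l x.

Lemma pert0 : pert 0 = g.
Proof. by apply: funext => y; rewrite /pert scale0r addr0. Qed.

Lemma smooth_pert s : smooth_field U (pert s).
Proof.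
move=> i j; apply: (eq_smooth oU (f := fun y => g y i j + s * h y i j)).
  by move=> y _; rewrite !mxE.
apply: (smooth_add oU); first exact: metric_smooth gm i j.
by apply: (smooth_mul oU); [exact: smooth_cst|exact: hs i j].
Qed.

(** Invertibility of the perturbed matrix is an open condition, which is why
    the domain shrinks with [s]. *)
Lemma pert_metric s : local_metric (pert_dom s) (pert s).
Proof.
have sub : pert_dom s `<=` U by move=> y [].
split.
- rewrite openE => y [Uy uy]; apply: filterI; first exact: open_nbhs_nbhs.
  have cd : {for y, continuous (fun z => \det (pert s z))}.
    by apply: smooth_continuous Uy; apply: smooth_det => //; exact: smooth_pert.
  have d0 : \det (pert s y) != 0 by rewrite -unitfE -unitmxE.
  have nd : nbhs y [set z | \det (pert s z) != 0] by exact: cvgr_neq0 cd d0.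
  by move: nd; apply: filterS => z; rewrite /= unitmxE unitfE.
- by move=> i j; apply: smooth_subset sub (smooth_pert s i j).
- by move=> y /sub Uy; rewrite /pert linearD linearZ /= hsym // (metric_symmetric gm).
- by move=> y [].
Qed.

Lemma smooth_dchristoffel_low i j l : smooth_on U (dchristoffel_low i j l).
Proof. by apply: smooth_sub => //; apply: smooth_add. Qed.

Lemma smooth_dchristoffel s k i j : smooth_on (pert_dom s) (dchristoffel s k i j).
Proof.
have om := metric_open (pert_metric s).
apply: smooth_mul => //; first exact: smooth_cst.
apply: smooth_sum => // l; apply: smooth_mul => //.
  exact: smooth_gup (pert_metric s) k l.
by apply: smooth_subset (smooth_dchristoffel_low i j l) => y [].
Qed.

Lemma partial_pert s k i j x : U x -> partial k (fun y => pert s y i j) x =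
  partial k (fun y => g y i j) x + s * partial k (fun y => h y i j) x.
Proof.
move=> Ux; rewrite -(partialZ oU _ _ (hs i j) Ux).
have sh : smooth_on U (fun y => s * h y i j).
  by apply: (smooth_mul oU); [exact: smooth_cst|exact: hs i j].
rewrite -(partialD k (metric_smooth gm i j) sh Ux).
by apply: (eq_partial oU) => // y _; rewrite !mxE.
Qed.

Lemma nabla_pert s k i j x : U x ->
  nabla g (pert s) k i j x = s * nabla g h k i j x.
Proof.
move=> Ux; rewrite -[RHS]add0r -(nabla_metric gm k i j Ux) /nabla partial_pert //.
have S1 : \sum_(a < n) Gam a k i x * pert s x a j =
    \sum_(a < n) Gam a k i x * g x a j + s * \sum_(a < n) Gam a k i x * h x a j.
  rewrite mulr_sumr -big_split; apply: eq_bigr => a _.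
  by rewrite !mxE /=; ring_atoms.
have S2 : \sum_(a < n) Gam a k j x * pert s x i a =
    \sum_(a < n) Gam a k j x * g x i a + s * \sum_(a < n) Gam a k j x * h x i a.
  rewrite mulr_sumr -big_split; apply: eq_bigr => a _.
  by rewrite !mxE /=; ring_atoms.
by rewrite S1 S2; ring_atoms.
Qed.

(** Since nabla g = 0, the covariant derivative of g + s h is s nabla h, so
    the difference of connections is exactly divisible by [s]. *)
Lemma christoffel_pert s k i j x : pert_dom s x ->
  christoffel (pert s) k i j x = Gam k i j x + s * dchristoffel s k i j x.
Proof.
move=> Vx; have [Ux _] := Vx.
rewrite (christoffel_change k i j gm (pert_metric s) Ux Vx); congr (_ + _).
rewrite mulrCA; congr (_ * _); rewrite mulr_sumr; apply: eq_bigr => l _.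
by rewrite !nabla_pert // /dchristoffel_low; ring_atoms.
Qed.

(** The part of (Ric(g_s) - Ric(g)) / s that is linear in the difference tensor
    of the two connections. *)
Definition dricci s i j x : R := \sum_(k < n)
  (partial k (dchristoffel s k i j) x - partial i (dchristoffel s k k j) x
   + \sum_(e < n) (Gam k k e x * dchristoffel s e i j x
                 + dchristoffel s k k e x * Gam e i j x
                 - Gam k i e x * dchristoffel s e k j x
                 - dchristoffel s k i e x * Gam e k j x)).

Definition d2ricci s i j x : R := \sum_(k < n) \sum_(e < n)
  (dchristoffel s k k e x * dchristoffel s e i j x
   - dchristoffel s k i e x * dchristoffel s e k j x).

(** The curvature is quadratic in the connection coefficients: the terms of
    degree one and two in the difference tensor give the two coefficients. *)
Lemma ricci_pert s i j x : pert_dom s x -> ricci (pert s) x i j =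
  ricci g x i j + s * (dricci s i j x + s * d2ricci s i j x).
Proof.
move=> Vx; have [Ux _] := Vx; have om := metric_open (pert_metric s).
have sD k p q := smooth_dchristoffel s k p q.
have sG' k p q : smooth_on (pert_dom s) (Gam k p q).
  by apply: smooth_subset (sG k p q) => y [].
have dG a k p q : partial a (christoffel (pert s) k p q) x =
    partial a (Gam k p q) x + s * partial a (dchristoffel s k p q) x.
  rewrite -(partialZ om _ _ (sD _ _ _) Vx).
  have sd : smooth_on (pert_dom s) (fun y => s * dchristoffel s k p q y).
    by apply: (smooth_mul om); [exact: smooth_cst|exact: sD].
  rewrite -(partialD a (sG' k p q) sd Vx).
  by apply: (eq_partial om) => // y Vy; exact: christoffel_pert.
rewrite !mxE /dricci /d2ricci mulr_sumr -big_split mulr_sumr -big_split /=.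
apply: eq_bigr => k _; rewrite /riemann !dG.
set S0 := \sum_(e < n) _; set S := \sum_(e < n) _.
set S1 := \sum_(e < n) _; set S2 := \sum_(e < n) _.
suff -> : S0 = S + s * S1 + s * (s * S2) by ring_atoms.
rewrite /S0 /S /S1 /S2 !mulr_sumr -!big_split; apply: eq_bigr => e _ /=.
rewrite (christoffel_pert k k e Vx) (christoffel_pert e i j Vx).
by rewrite (christoffel_pert k i e Vx) (christoffel_pert e k j Vx);
  move: (dchristoffel s) => D; ring_atoms.
Qed.

End Variation.

(** * Derivative of the Ricci curvature *)

Section RicciDerivative.
Variables (R : realType) (n : nat) (U : set 'rV[R]_n).
Variables g h : 'rV[R]_n -> 'M[R]_n.
Hypothesis gm : local_metric U g.
Hypothesis hs : smooth_field U h.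
Hypothesis hsym : symmetric_field U h.
Variable x : 'rV[R]_n.
Hypothesis Ux : U x.
Implicit Types (s : R) (i j k l a b c d e : 'I_n).

Lemma cvg_pert i j : pert g h s x i j @[s --> (0 : R)] --> g x i j.
Proof.
have -> : (fun s : R => pert g h s x i j) = (fun s => g x i j + s * h x i j).
  by apply: funext => s; rewrite !mxE.
rewrite -[X in _ --> X]addr0 -[X in _ --> _ + X](mul0r (h x i j)).
apply: cvgD; first exact: cvg_cst.
by apply: cvgM; [exact: cvg_id|exact: cvg_cst].
Qed.

Lemma near_pert_dom : \forall s \near (0 : R), pert_dom U g h s x.
Proof.
have d0 : \det (g x) != 0 by rewrite -unitfE -unitmxE (metric_unit gm).
have nd : \forall s \near (0 : R), \det (pert g h s x) != 0.
  exact: cvgr_neq0 (cvg_det _ cvg_pert) d0.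
by apply: filterS nd => s ds; split => //=; rewrite unitmxE unitfE.
Qed.

Lemma cvg_gup_pert i j : gup (pert g h s) x i j @[s --> (0 : R)] --> gup g x i j.
Proof. exact: (cvg_invmx _ (metric_unit gm Ux) cvg_pert). Qed.

Lemma cvg_dchristoffel k i j :
  dchristoffel g h s k i j x @[s --> (0 : R)] --> dchristoffel g h 0 k i j x.
Proof.
apply: cvgM; first exact: cvg_cst.
apply: cvg_big => [|l _]; first exact: add_continuous.
apply: cvgM; last exact: cvg_cst.
by rewrite pert0; exact: cvg_gup_pert.
Qed.

Let partial_dchristoffel_val (P : 'M[R]_n) s a k i j : R :=
  2^-1 * \sum_(l < n)
    (- (\sum_(c < n) \sum_(d < n) P k c *
         (partial a (fun y => g y c d) x + s * partial a (fun y => h y c d) x)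
         * P d l) * dchristoffel_low g h i j l x
     + P k l * partial a (dchristoffel_low g h i j l) x).

Let partial_dchristoffelE s a k i j : pert_dom U g h s x ->
  partial a (dchristoffel g h s k i j) x =
  partial_dchristoffel_val (gup (pert g h s) x) s a k i j.
Proof.
move=> Vx; have pm := pert_metric gm hs hsym s; have om := metric_open pm.
have sN l : smooth_on (pert_dom U g h s) (dchristoffel_low g h i j l).
  by apply: smooth_subset (smooth_dchristoffel_low gm hs i j l) => y [].
have sPN l : smooth_on (pert_dom U g h s)
    (fun y => gup (pert g h s) y k l * dchristoffel_low g h i j l y).
  by apply: (smooth_mul om); [exact: smooth_gup pm k l|exact: sN].
rewrite (partialZ om _ _ (smooth_sum om _ _ sPN) Vx); congr (_ * _).
rewrite (partial_sum om _ _ sPN Vx); apply: eq_bigr => l _.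
rewrite (partialM a (smooth_gup pm k l) (sN l) Vx) (partial_gup pm _ _ _ Vx).
congr (- _ * _ + _); apply: eq_bigr => c _; apply: eq_bigr => d _.
by rewrite (partial_pert gm hs _ _ _ _ Ux).
Qed.

(** The derivative is made explicit through the derivative of the inverse
    matrix, which is valid for all [s] close to 0. *)
Lemma cvg_partial_dchristoffel a k i j :
  partial a (dchristoffel g h s k i j) x @[s --> (0 : R)] -->
  partial a (dchristoffel g h 0 k i j) x.
Proof.
have V0 : pert_dom U g h 0 x := nbhs_singleton near_pert_dom.
rewrite (partial_dchristoffelE a k i j V0) pert0.
have nE : \forall s \near (0 : R),
    partial_dchristoffel_val (gup (pert g h s) x) s a k i j =
    partial a (dchristoffel g h s k i j) x.
  by apply: filterS near_pert_dom => s /partial_dchristoffelE ->.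
apply: cvg_trans (near_eq_cvg nE) _.
apply: cvgM; first exact: cvg_cst.
apply: cvg_big => [|l _]; first exact: add_continuous.
apply: cvgD; last by apply: cvgM; [exact: cvg_gup_pert|exact: cvg_cst].
apply: cvgM; last exact: cvg_cst.
apply: cvgN; apply: cvg_big => [|c _]; first exact: add_continuous.
apply: cvg_big => [|d _]; first exact: add_continuous.
apply: cvgM; last exact: cvg_gup_pert.
apply: cvgM; first exact: cvg_gup_pert.
apply: cvgD; first exact: cvg_cst.
by apply: cvgM; [exact: cvg_id|exact: cvg_cst].
Qed.

Lemma cvg_dricci i j :
  dricci g h s i j x @[s --> (0 : R)] --> dricci g h 0 i j x.
Proof.
have cD k p q := @cvg_dchristoffel k p q.
apply: cvg_big => [|k _]; first exact: add_continuous.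
apply: cvgD.
  by apply: cvgB; exact: cvg_partial_dchristoffel.
apply: cvg_big => [|e _]; first exact: add_continuous.
apply: cvgB; last by apply: cvgM; [exact: cD|exact: cvg_cst].
apply: cvgB; last by apply: cvgM; [exact: cvg_cst|exact: cD].
apply: cvgD; first by apply: cvgM; [exact: cvg_cst|exact: cD].
by apply: cvgM; [exact: cD|exact: cvg_cst].
Qed.

Lemma cvg_d2ricci i j :
  d2ricci g h s i j x @[s --> (0 : R)] --> d2ricci g h 0 i j x.
Proof.
have cD k p q := @cvg_dchristoffel k p q.
apply: cvg_big => [|k _]; first exact: add_continuous.
apply: cvg_big => [|e _]; first exact: add_continuous.
by apply: cvgB; apply: cvgM; exact: cD.
Qed.

(** The difference quotient is equal to dricci + s d2ricci by [ricci_pert], and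
    both coefficients are continuous at s = 0. *)
Lemma is_derive_ricci i j :
  is_derive (0 : R) 1 (fun s => ricci (pert g h s) x i j) (dricci g h 0 i j x).
Proof.
have H : (fun s : R => s^-1 *: (ricci (pert g h (s *: 1 + 0)) x i j
    - ricci (pert g h 0) x i j)) @ 0^' --> dricci g h 0 i j x.
  have nE : \forall s \near 0^', dricci g h s i j x + s * d2ricci g h s i j x
      = s^-1 *: (ricci (pert g h (s *: 1 + 0)) x i j
                 - ricci (pert g h 0) x i j).
    rewrite near_withinE; apply: filterS near_pert_dom => s Vs s0.
    rewrite addr0 pert0 /GRing.scale /= mulr1 (ricci_pert gm hs hsym _ _ Vs).
    by rewrite addrAC subrr add0r mulKf.
  apply: cvg_trans (near_eq_cvg nE) _; apply: cvg_within_filter.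
  have -> : dricci g h 0 i j x = dricci g h 0 i j x + 0 * d2ricci g h 0 i j x.
    by rewrite mul0r addr0.
  apply: cvgD; first exact: cvg_dricci.
  by apply: cvgM; [exact: cvg_id|exact: cvg_d2ricci].
split; first by apply/cvg_ex; eexists; exact: H.
exact: cvg_lim H.
Qed.

Lemma derivable_ricci : derivable (fun s : R => ricci (pert g h s) x) 0 1.
Proof.
by apply/derivable_mxP => i j; have [] := is_derive_ricci i j.
Qed.

Lemma ricci_lin_dricci i j : ricci_lin g h x i j = dricci g h 0 i j x.
Proof.
rewrite /ricci_lin derive1E (derive_mx derivable_ricci) mxE.
by have [] := is_derive_ricci i j.
Qed.

End RicciDerivative.

(** * The linearized Ricci curvature and the Lichnerowicz Laplacian *)

Section LinearizedRicci.
Variables (R : realType) (n : nat) (U : set 'rV[R]_n).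
Variables g h : 'rV[R]_n -> 'M[R]_n.
Hypothesis gm : local_metric U g.
Hypothesis hs : smooth_field U h.
Hypothesis hsym : symmetric_field U h.
Implicit Types (x y : 'rV[R]_n) (i j k l a b c d e : 'I_n).

Let oU : open U := metric_open gm.
Local Notation "'Gam'" := (christoffel g).
Local Notation N := (dchristoffel_low g h).
Local Notation D := (dchristoffel g h 0).
Local Notation tau := (trace_g g h).
Let sP i j : smooth_on U (fun x => gup g x i j) := smooth_gup gm i j.
Let sN i j l : smooth_on U (N i j l) := smooth_dchristoffel_low gm hs i j l.

Let DE k i j : D k i j = fun y => 2^-1 * \sum_(l < n) gup g y k l * N i j l y.
Proof. by rewrite /dchristoffel pert0. Qed.

Let sD k i j : smooth_on U (D k i j).
Proof.
rewrite DE; apply: (smooth_mul oU); first exact: smooth_cst.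
by apply: (smooth_sum oU) => l; exact: (smooth_mul oU).
Qed.

(** In the trace the first and the third of the three terms of the lowered
    tensor cancel by symmetry. *)
Lemma trace_dchristoffel j x : U x ->
  \sum_(k < n) D k k j x = 2^-1 * partial j tau x.
Proof.
move=> Ux; rewrite (partial_trace gm hs j Ux).
under eq_bigr do rewrite DE; rewrite -mulr_sumr; congr (_ * _).
transitivity (\sum_(k < n) \sum_(l < n) gup g x k l * nabla g h j k l x +
  (\sum_(k < n) \sum_(l < n) gup g x k l * nabla g h k j l x -
   \sum_(k < n) \sum_(l < n) gup g x k l * nabla g h l k j x)).
  rewrite -sumrB -big_split; apply: eq_bigr => k _; rewrite -sumrB -big_split.
  by apply: eq_bigr => l _; rewrite /dchristoffel_low /=; ring_atoms.
rewrite [X in _ + (_ - X)]exchange_big -[RHS]addr0; congr (_ + _).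
apply/eqP; rewrite subr_eq0; apply/eqP.
apply: eq_bigr => k _; apply: eq_bigr => l _.
by rewrite (gupC gm k l Ux) (nabla_sym gm k j l hsym Ux).
Qed.

(** The term with Gamma^k_ke is the one that [partial_raise] produces for the
    raised index, so that the derivative falls on the lowered tensor only. *)
Lemma divergence_dchristoffel k i j x : U x ->
  partial k (D k i j) x + \sum_(e < n) Gam k k e x * D e i j x =
  2^-1 * \sum_(l < n) gup g x k l *
    (partial k (N i j l) x - \sum_(a < n) Gam a k l x * N i j a x).
Proof.
move=> Ux; have sPN l : smooth_on U (fun y => gup g y k l * N i j l y).
  exact: (smooth_mul oU).
rewrite [X in partial k X]DE (partialZ oU _ _ (smooth_sum oU _ _ sPN) Ux).
rewrite (partial_raise gm _ _ (sN i j) Ux) mulrBr -addrA.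
rewrite -[RHS]addr0; congr (_ + _); apply/eqP; rewrite addrC subr_eq0; apply/eqP.
rewrite mulr_sumr; apply: eq_bigr => e _; rewrite DE.
by ring_atoms.
Qed.

(** Grouping by covariant derivatives: the first three sums are the divergence
    of the difference tensor, the last two the derivative of its trace. *)
Lemma dricci_split i j x : dricci g h 0 i j x =
  \sum_(k < n) (partial k (D k i j) x + \sum_(e < n) Gam k k e x * D e i j x)
  - \sum_(k < n) \sum_(e < n) Gam k i e x * D e k j x
  - \sum_(k < n) \sum_(e < n) D k i e x * Gam e k j x
  - (\sum_(k < n) partial i (D k k j) x
     - \sum_(k < n) \sum_(e < n) D k k e x * Gam e i j x).
Proof.
rewrite -!sumrB; apply: eq_bigr => k _.
have -> : \sum_(e < n) (Gam k k e x * D e i j x + D k k e x * Gam e i j x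
      - Gam k i e x * D e k j x - D k i e x * Gam e k j x) =
    \sum_(e < n) Gam k k e x * D e i j x + \sum_(e < n) D k k e x * Gam e i j x
    - \sum_(e < n) Gam k i e x * D e k j x
    - \sum_(e < n) D k i e x * Gam e k j x.
  by rewrite -big_split -!sumrB.
by ring_atoms.
Qed.

Lemma nabla_dchristoffel_low k i j l x : U x ->
  partial k (N i j l) x - \sum_(a < n) Gam a k l x * N i j a x
  - \sum_(a < n) Gam a k i x * N a j l x - \sum_(a < n) Gam a k j x * N i a l x
  = nabla2 g h k i j l x + nabla2 g h k j i l x - nabla2 g h k l i j x.
Proof.
move=> Ux; have sNa a b c := smooth_nabla gm a b c hs.
have -> : partial k (N i j l) x = partial k (nabla g h i j l) x
    + partial k (nabla g h j i l) x - partial k (nabla g h l i j) x.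
  rewrite (partialB oU k (smooth_add oU (sNa i j l) (sNa j i l)) (sNa l i j) Ux).
  by rewrite (partialD k (sNa i j l) (sNa j i l) Ux).
have S3 (F A B C : 'I_n -> R) : \sum_(a < n) F a * (A a + B a - C a) =
    \sum_(a < n) F a * A a + \sum_(a < n) F a * B a - \sum_(a < n) F a * C a.
  rewrite -big_split -sumrB; apply: eq_bigr => a _ /=; ring.
have E1 : \sum_(a < n) Gam a k l x * N i j a x =
    \sum_(a < n) Gam a k l x * nabla g h i j a x
    + \sum_(a < n) Gam a k l x * nabla g h j i a x
    - \sum_(a < n) Gam a k l x * nabla g h a i j x by exact: S3.
have E2 : \sum_(a < n) Gam a k i x * N a j l x =
    \sum_(a < n) Gam a k i x * nabla g h a j l x
    + \sum_(a < n) Gam a k i x * nabla g h j a l x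
    - \sum_(a < n) Gam a k i x * nabla g h l a j x by exact: S3.
have E3 : \sum_(a < n) Gam a k j x * N i a l x =
    \sum_(a < n) Gam a k j x * nabla g h i a l x
    + \sum_(a < n) Gam a k j x * nabla g h a i l x
    - \sum_(a < n) Gam a k j x * nabla g h l i a x by exact: S3.
by rewrite E1 E2 E3 /nabla2; ring_atoms.
Qed.

(** The Palatini formula, with the traced difference tensor expressed through
    the Hessian of the trace of [h]. *)
Lemma dricciE i j x : U x -> dricci g h 0 i j x = 2^-1 *
  (\sum_(k < n) \sum_(l < n) gup g x k l * (nabla2 g h k i j l x
     + nabla2 g h k j i l x - nabla2 g h k l i j x)
   - (partial i (partial j tau) x - \sum_(a < n) Gam a i j x * partial a tau x)).
Proof.
move=> Ux; rewrite dricci_split mulrBr mulrBr; congr (_ - (_ - _)).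
- under [X in X - _ - _]eq_bigr do rewrite (divergence_dchristoffel _ _ _ Ux).
  have -> : \sum_(k < n) \sum_(e < n) Gam k i e x * D e k j x =
      \sum_(k < n) 2^-1 * \sum_(l < n) gup g x k l *
        \sum_(a < n) Gam a k i x * N a j l x.
    rewrite exchange_big; apply: eq_bigr => k _ /=.
    under eq_bigr do rewrite DE mulrCA mulr_sumr.
    rewrite -mulr_sumr; congr (_ * _); rewrite exchange_big.
    apply: eq_bigr => l _ /=; rewrite mulr_sumr; apply: eq_bigr => a _.
    by rewrite (christoffelC gm a i k Ux) mulrCA.
  have -> : \sum_(k < n) \sum_(e < n) D k i e x * Gam e k j x =
      \sum_(k < n) 2^-1 * \sum_(l < n) gup g x k l *
        \sum_(a < n) Gam a k j x * N i a l x.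
    apply: eq_bigr => k _.
    under eq_bigr do rewrite DE -mulrA mulr_suml.
    rewrite -mulr_sumr; congr (_ * _); rewrite exchange_big.
    apply: eq_bigr => l _ /=; rewrite mulr_sumr; apply: eq_bigr => a _.
    by rewrite -mulrA; congr (_ * _); exact: mulrC.
  rewrite -!sumrB mulr_sumr; apply: eq_bigr => k _.
  rewrite -!mulrBr; congr (_ * _); rewrite -!sumrB; apply: eq_bigr => l _.
  by rewrite -!mulrBr nabla_dchristoffel_low.
- rewrite -(partialZ oU) //; last first.
    by apply: smooth_partial; exact: (smooth_trace gm hs).
  rewrite -(partial_sum oU) //.
  by apply: (eq_partial oU) => // y Uy; rewrite trace_dchristoffel.
- rewrite exchange_big mulr_sumr; apply: eq_bigr => e _ /=.
  by rewrite -mulr_suml (trace_dchristoffel e Ux); ring_atoms.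
Qed.

Hypothesis gauge : forall y, U y -> forall j,
  delta_g g h j y = - (2^-1 * partial j tau y).

(** Symmetrizing [contracted_ricci_identity] in [i] and [j], the two divergence
    terms add up to the Hessian of the trace under the gauge condition.  The
    curvature terms combine because the curvature operator preserves symmetric
    tensors and the Ricci tensor is symmetric. *)
Lemma dricci_lichnerowicz i j x : U x ->
  dricci g h 0 i j x = 2^-1 * lichnerowicz g h x i j.
Proof.
move=> Ux; rewrite (dricciE i j Ux); congr (_ * _).
(* The right-hand side of the contracted identity under the gauge condition. *)
pose V p q : R := 2^-1 * (partial p (partial q tau) x
      - \sum_(a < n) Gam a p q x * partial a tau x)
    - Rring g h x p q + (ricci g x *m gup g x *m h x) p q.
have W p q : \sum_(k < n) \sum_(l < n) gup g x k l * nabla2 g h k p q l x = V p q.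
  rewrite (contracted_ricci_identity gm hs hsym p q Ux); congr (_ - _ + _).
  have sdt : smooth_on U (partial q tau).
    by apply: smooth_partial; exact: (smooth_trace gm hs).
  have shdt : smooth_on U (fun y => 2^-1 * partial q tau y).
    by apply: (smooth_mul oU) => //; exact: smooth_cst.
  rewrite (eq_partial oU _ Ux (fun y Uy => gauge Uy q)).
  rewrite (partialN oU _ shdt Ux) (partialZ oU _ _ sdt Ux).
  under eq_bigr do rewrite (gauge Ux).
  rewrite mulrBr mulr_sumr opprB addrC -sumrN opprK; congr (_ + _).
  by apply: eq_bigr => a _; ring_atoms.
have -> : \sum_(k < n) \sum_(l < n) gup g x k l * (nabla2 g h k i j l x
      + nabla2 g h k j i l x - nabla2 g h k l i j x)
  = V i j + V j i - \sum_(k < n) \sum_(l < n) gup g x k l * nabla2 g h k l i j x.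
  transitivity (\sum_(k < n) \sum_(l < n) gup g x k l * nabla2 g h k i j l x
    + \sum_(k < n) \sum_(l < n) gup g x k l * nabla2 g h k j i l x
    - \sum_(k < n) \sum_(l < n) gup g x k l * nabla2 g h k l i j x);
    last by congr (_ + _ - _); exact: W.
  rewrite -big_split -sumrB; apply: eq_bigr => k _.
  rewrite -big_split -sumrB; apply: eq_bigr => l _ /=.
  by ring_atoms.
rewrite /V (schwarz oU i j (smooth_trace gm hs) Ux).
have -> : \sum_(a < n) Gam a j i x * partial a tau x =
    \sum_(a < n) Gam a i j x * partial a tau x.
  by apply: eq_bigr => a _; rewrite (christoffelC gm a j i Ux).
have -> : (ricci g x *m gup g x *m h x) j i = (h x *m gup g x *m ricci g x) i j.
  have RT : (ricci g x)^T = ricci g x.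
    by apply/matrixP => p q; rewrite [LHS]mxE (ricci_sym gm).
  have PT : (gup g x)^T = gup g x.
    by apply/matrixP => p q; rewrite [LHS]mxE (gupC gm).
  transitivity ((ricci g x *m gup g x *m h x)^T i j); first by rewrite [RHS]mxE.
  by rewrite !trmx_mul RT PT hsym // mulmxA.
rewrite (Rring_sym gm hsym j i Ux).
have -> : lichnerowicz g h x i j = rough_laplacian g h x i j
    - 2 * Rring g h x i j + (ricci g x *m gup g x *m h x) i j
    + (h x *m gup g x *m ricci g x) i j.
  rewrite /lichnerowicz; move: (ricci g x *m _ *m _) (h x *m _ *m _) => A B.
  by move: (rough_laplacian g h x) (Rring g h x) => C E; rewrite !mxE.
rewrite [rough_laplacian g h x i j]mxE.
by generalize_atoms; field.
Qed.

End LinearizedRicci.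

(** * From charts to tensor fields *)

(** A nonzero row of the kernel would be a null vector of the quadratic form. *)
Lemma posdef_unitmx (R : realType) (n : nat) (A : 'M[R]_n) :
  (forall v : 'rV[R]_n, v != 0 -> 0 < (v *m A *m v^T) ord0 ord0) ->
  A \in unitmx.
Proof.
move=> pA; rewrite -row_free_unit -kermx_eq0; apply/eqP/row_matrixP => i.
rewrite row0; apply/eqP; apply: contraT => ri0.
have := pA _ ri0; rewrite -row_mul mulmx_ker row0 mul0mx mxE ltxx //.
Qed.

Section InChart.
Variables (R : realType) (n : nat) (T : topologicalType) (M : manifold R n T).
Variable g : tensor_field M.
Hypothesis rg : riemannian_metric g.

Lemma chart_metric a : local_metric (chart_img (atlas a)) (g a).
Proof.
have [[gs gsym _] gp] := rg; split.
- exact: chart_img_open.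
- by move=> i j; exact: gs.
- by move=> y; exact: gsym.
- by move=> y /gp; exact: posdef_unitmx.
Qed.

Lemma ricci_lin_lichnerowicz h : sym2_tensor h -> chen_nagano g h ->
  forall a x, chart_img (atlas a) x ->
    derivable (fun s : R => ricci (fun y => g a y + s *: h a y) x) 0 1 /\
    ricci_lin (g a) (h a) x = 2^-1 *: lichnerowicz (g a) (h a) x.
Proof.
move=> [hs hsym _] gauge a x Ux.
have gm := chart_metric a.
have hs' : smooth_field (chart_img (atlas a)) (h a) by move=> i j; exact: hs.
have hsym' : symmetric_field (chart_img (atlas a)) (h a).
  by move=> y; exact: hsym.
split; first exact: (derivable_ricci gm hs' hsym' Ux).
apply/matrixP => i j; rewrite [RHS]mxE (ricci_lin_dricci gm hs' hsym' Ux).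
by apply: (dricci_lichnerowicz gm hs' hsym') => // y Uy; exact: gauge.
Qed.

Lemma eq_evolves_by (L L' : tensor_field M -> tensor_field M) (J : interval R)
    (h : R -> tensor_field M) :
  (forall t, t \in J -> forall a x, chart_img (atlas a) x ->
    L (h t) a x = L' (h t) a x) ->
  evolves_by L J h <-> evolves_by L' J h.
Proof.
move=> LL'; split=> ev t tJ a x Ux; have := ev t tJ a x Ux.
  by rewrite LL'.
by rewrite LL'.
Qed.

End InChart.

(** * Principal symbol of the Lichnerowicz Laplacian *)

Section FirstOrder.
Variables (R : realType) (n : nat) (U : set 'rV[R]_n).
Hypothesis oU : open U.
Implicit Types (h : 'rV[R]_n -> 'M[R]_n) (x : 'rV[R]_n).
Implicit Types (i j k l a b c d e p q : 'I_n).
Implicit Types (E : ('rV[R]_n -> 'M[R]_n) -> 'rV[R]_n -> R).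

(** A differential operator of order at most one with smooth coefficients, as a
    property of its values on smooth fields; it lets lower order terms be
    discarded without computing them. *)
Definition first_order E : Prop :=
  exists (B : 'I_n -> 'I_n -> 'I_n -> 'rV[R]_n -> R)
         (C : 'I_n -> 'I_n -> 'rV[R]_n -> R),
  [/\ forall k l p, smooth_on U (B k l p), forall k l, smooth_on U (C k l)
    & forall h, smooth_field U h -> forall x, U x -> E h x =
        \sum_(k < n) \sum_(l < n)
          (\sum_(p < n) B k l p x * partial p (fun y => h y k l) x
           + C k l x * h x k l)].

Lemma eq_first_order E E' :
  (forall h, smooth_field U h -> forall x, U x -> E h x = E' h x) ->
  first_order E -> first_order E'.
Proof.
move=> EE' [B [C [sB sC EBC]]]; exists B, C; split => // h hs x Ux.
by rewrite -EE' // EBC.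
Qed.

Lemma first_order_add E E' : first_order E -> first_order E' ->
  first_order (fun h x => E h x + E' h x).
Proof.
move=> [B [C [sB sC EBC]]] [B' [C' [sB' sC' EBC']]].
exists (fun k l p x => B k l p x + B' k l p x), (fun k l x => C k l x + C' k l x).
split => [k l p|k l|h hs x Ux]; try exact: (smooth_add oU).
rewrite (EBC _ hs _ Ux) (EBC' _ hs _ Ux) -big_split; apply: eq_bigr => k _ /=.
rewrite -big_split; apply: eq_bigr => l _ /=.
rewrite addrACA mulrDl -big_split; congr (_ + _).
by apply: eq_bigr => p _; rewrite mulrDl.
Qed.

Lemma first_order_mul (f : 'rV[R]_n -> R) E : smooth_on U f -> first_order E ->
  first_order (fun h x => f x * E h x).
Proof.
move=> sf [B [C [sB sC EBC]]].
exists (fun k l p x => f x * B k l p x), (fun k l x => f x * C k l x).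
split => [k l p|k l|h hs x Ux]; try exact: (smooth_mul oU).
rewrite (EBC _ hs _ Ux) mulr_sumr; apply: eq_bigr => k _ /=.
rewrite mulr_sumr; apply: eq_bigr => l _ /=.
rewrite mulrDr mulr_sumr mulrA; congr (_ + _).
by apply: eq_bigr => p _; rewrite mulrA.
Qed.

Lemma first_order_opp E : first_order E -> first_order (fun h x => - E h x).
Proof.
move=> fE; apply: eq_first_order (first_order_mul (smooth_cst oU (-1)) fE).
by move=> h _ x _; rewrite mulN1r.
Qed.

Lemma first_order_sub E E' : first_order E -> first_order E' ->
  first_order (fun h x => E h x - E' h x).
Proof.
by move=> fE fE'; exact: first_order_add fE (first_order_opp fE').
Qed.

Lemma first_order_entry i j : first_order (fun h x => h x i j).
Proof.
exists (fun _ _ _ _ => 0), (fun k l _ => (i == k)%:R * (j == l)%:R).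
split => [k l p|k l|h hs x Ux]; try exact: (smooth_cst oU).
under eq_bigr => k _.
  under eq_bigr => l _.
    rewrite big1 => [|p _]; last by rewrite mul0r.
    rewrite add0r -mulrA; over.
  rewrite -mulr_sumr sum_deltal; over.
by rewrite sum_deltal.
Qed.

Lemma first_order_partial q i j :
  first_order (fun h x => partial q (fun y => h y i j) x).
Proof.
exists (fun k l p _ => (i == k)%:R * ((j == l)%:R * (q == p)%:R)), (fun _ _ _ => 0).
split => [k l p|k l|h hs x Ux]; try exact: (smooth_cst oU).
under eq_bigr => k _.
  under eq_bigr => l _.
    rewrite mul0r addr0; under eq_bigr => p _ do rewrite -mulrA -mulrA.
    rewrite -mulr_sumr -mulr_sumr sum_deltal; over.
  rewrite -mulr_sumr sum_deltal; over.
by rewrite sum_deltal.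
Qed.

Lemma first_order_sum (I : Type) (r : seq I)
    (F : I -> ('rV[R]_n -> 'M[R]_n) -> 'rV[R]_n -> R) :
  (forall m : I, first_order (F m)) ->
  first_order (fun h x => \sum_(m <- r) F m h x).
Proof.
move=> fF; elim: r => [|m r IH].
  exists (fun _ _ _ _ => 0), (fun _ _ _ => 0).
  split => [k l p|k l|h hs x Ux]; try exact: (smooth_cst oU).
  rewrite big_nil big1 // => k _; rewrite big1 // => l _.
  by rewrite mul0r addr0 big1 // => p _; rewrite mul0r.
by apply: eq_first_order (first_order_add (fF m) IH) => h _ x _; rewrite big_cons.
Qed.

End FirstOrder.

Section Symbol.
Variables (R : realType) (n : nat) (U : set 'rV[R]_n).
Variable g : 'rV[R]_n -> 'M[R]_n.
Hypothesis gm : local_metric U g.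
Implicit Types (h : 'rV[R]_n -> 'M[R]_n) (x : 'rV[R]_n).
Implicit Types (i j k l a b c d e p q : 'I_n).

Let oU : open U := metric_open gm.
Local Notation "'Gam'" := (christoffel g).
Let sG a p q : smooth_on U (Gam a p q) := smooth_christoffel gm a p q.
Let sP i j : smooth_on U (fun x => gup g x i j) := smooth_gup gm i j.
Let sdG k a p q : smooth_on U (partial k (Gam a p q)) :=
  smooth_partial k (sG a p q).

Lemma smooth_riemann a b c d : smooth_on U (riemann g a b c d).
Proof.
apply: (smooth_add oU); first by apply: (smooth_sub oU); exact: sdG.
by apply: (smooth_sum oU) => e; apply: (smooth_sub oU); apply: (smooth_mul oU).
Qed.

Lemma smooth_riemann_low i k j l : smooth_on U (riemann_low g i k j l).
Proof.
apply: (smooth_sum oU) => d; apply: (smooth_mul oU).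
  exact: metric_smooth gm l d.
exact: smooth_riemann.
Qed.

Lemma smooth_ricci i j : smooth_on U (fun x => ricci g x i j).
Proof.
apply: (eq_smooth oU (f := fun x => \sum_(k < n) riemann g k i j k x)).
  by move=> x _; rewrite mxE.
by apply: (smooth_sum oU) => k; exact: smooth_riemann.
Qed.

Local Notation fo_coef := (first_order_mul oU).

Lemma first_order_nabla k i j : first_order U (fun h x => nabla g h k i j x).
Proof.
apply: (first_order_sub oU); first apply: (first_order_sub oU).
- exact: (first_order_partial oU).
- by apply: (first_order_sum oU) => a; apply: fo_coef => //;
    exact: (first_order_entry oU).
- by apply: (first_order_sum oU) => a; apply: fo_coef => //;
    exact: (first_order_entry oU).
Qed.

(** Expanding the second covariant derivative, each term other than the second
    partial derivative carries a Christoffel symbol or a derivative of one. *)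
Lemma nabla2_symbol k l i j : first_order U
  (fun h x => nabla2 g h k l i j x - partial k (partial l (fun y => h y i j)) x).
Proof.
have fe a b := first_order_entry oU a b.
have fp c a b := first_order_partial oU c a b.
pose Z h x :=
  \sum_(a < n) partial k (Gam a l i) x * h x a j
  + \sum_(a < n) Gam a l i x * partial k (fun y => h y a j) x
  + \sum_(a < n) partial k (Gam a l j) x * h x i a
  + \sum_(a < n) Gam a l j x * partial k (fun y => h y i a) x
  + \sum_(a < n) Gam a k l x * nabla g h a i j x
  + \sum_(a < n) Gam a k i x * nabla g h l a j x
  + \sum_(a < n) Gam a k j x * nabla g h l i a x.
apply: (@eq_first_order _ _ _ (fun h x => - Z h x)).
  move=> h hs x Ux.
  have sGh a p q b c : smooth_on U (fun y => Gam a p q y * h y b c).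
    exact: (smooth_mul oU).
  rewrite /nabla2 (partial_nabla gm k l i j hs Ux) /Z; ring_atoms.
apply: (first_order_opp oU); rewrite /Z.
have fn a b c := first_order_nabla a b c.
by do 6?apply: (first_order_add oU); apply: (first_order_sum oU) => a;
  apply: fo_coef.
Qed.

Lemma first_order_mulmx (A B : 'rV[R]_n -> 'M[R]_n) i j :
  smooth_field U A -> smooth_field U B ->
  first_order U (fun h x => (A x *m h x *m B x) i j).
Proof.
move=> sA sB.
apply: (@eq_first_order _ _ _ (fun h x =>
  \sum_(b < n) B x b j * \sum_(a < n) A x i a * h x a b)).
  move=> h _ x _; rewrite mxE; apply: eq_bigr => b _.
  by rewrite mxE mulrC.
apply: (first_order_sum oU) => b; apply: fo_coef; first exact: sB.
apply: (first_order_sum oU) => a; apply: fo_coef; first exact: sA.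
exact: (first_order_entry oU).
Qed.

Lemma smooth_mulmx (A B : 'rV[R]_n -> 'M[R]_n) :
  smooth_field U A -> smooth_field U B -> smooth_field U (fun x => A x *m B x).
Proof.
move=> sA sB i j.
apply: (eq_smooth oU (f := fun x => \sum_(k < n) A x i k * B x k j)).
  by move=> x _; rewrite mxE.
by apply: (smooth_sum oU) => k; apply: (smooth_mul oU); [exact: sA|exact: sB].
Qed.

(** Only the rough Laplacian has order two; the curvature and Ricci terms are
    of order zero. *)
Lemma lichnerowicz_symbol i j : first_order U (fun h x =>
  - lichnerowicz g h x i j - \sum_(p < n) \sum_(q < n)
      gup g x p q * partial p (partial q (fun y => h y i j)) x).
Proof.
have s1 : smooth_field U (fun=> 1%:M : 'M[R]_n).
  move=> p q; apply: (eq_smooth oU (f := fun=> (1%:M : 'M[R]_n) p q)) => //.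
  exact: (smooth_cst oU).
have sPm : smooth_field U (gup g) by move=> p q; exact: sP.
have sRic : smooth_field U (ricci g) by move=> p q; exact: smooth_ricci.
pose Z h x := \sum_(p < n) \sum_(q < n) gup g x p q *
    (nabla2 g h p q i j x - partial p (partial q (fun y => h y i j)) x)
  + 2 * \sum_(k < n) \sum_(l < n) riemann_low g i k j l x *
      (gup g x *m h x *m gup g x) k l
  - ((ricci g x *m gup g x) *m h x *m 1%:M) i j
  - (1%:M *m h x *m (gup g x *m ricci g x)) i j.
apply: (@eq_first_order _ _ _ Z) => [h hs x Ux|].
  have -> : lichnerowicz g h x i j = rough_laplacian g h x i j
      - 2 * Rring g h x i j + (ricci g x *m gup g x *m h x) i j
      + (h x *m gup g x *m ricci g x) i j.
    rewrite /lichnerowicz; move: (ricci g x *m _ *m _) (h x *m _ *m _) => A B.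
    by move: (rough_laplacian g h x) (Rring g h x) => C E; rewrite !mxE.
  rewrite [rough_laplacian g h x i j]mxE [Rring g h x i j]mxE /Z mulmx1 mul1mx.
  rewrite mulmxA.
  have -> : \sum_(p < n) \sum_(q < n) gup g x p q *
      (nabla2 g h p q i j x - partial p (partial q (fun y => h y i j)) x)
    = \sum_(p < n) \sum_(q < n) gup g x p q * nabla2 g h p q i j x
    - \sum_(p < n) \sum_(q < n) gup g x p q *
        partial p (partial q (fun y => h y i j)) x.
    rewrite -sumrB; apply: eq_bigr => p _; rewrite -sumrB.
    by apply: eq_bigr => q _; rewrite mulrBr.
  by ring_atoms.
apply: (first_order_sub oU); last first.
  by apply: first_order_mulmx => //; exact: smooth_mulmx.
apply: (first_order_sub oU); last first.
  by apply: first_order_mulmx => //; exact: smooth_mulmx.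
apply: (first_order_add oU).
  apply: (first_order_sum oU) => p; apply: (first_order_sum oU) => q.
  by apply: fo_coef => //; exact: nabla2_symbol.
apply: fo_coef; first exact: (smooth_cst oU).
apply: (first_order_sum oU) => k; apply: (first_order_sum oU) => l.
apply: fo_coef; first exact: smooth_riemann_low.
exact: first_order_mulmx.
Qed.

End Symbol.

Lemma sum_delta2 (R : realType) (n : nat) (i j : 'I_n)
    (F : 'I_n -> 'I_n -> R) :
  \sum_(k < n) \sum_(l < n) (i == k)%:R * ((j == l)%:R * F k l) = F i j.
Proof.
under eq_bigr do rewrite -mulr_sumr sum_deltal.
by rewrite sum_deltal.
Qed.

Lemma sum_mul2 (R : realType) (n : nat) (u v : R) (F G : 'I_n -> 'I_n -> R) :
  \sum_(p < n) \sum_(q < n) u * (v * F p q) * G p q =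
  u * (v * \sum_(p < n) \sum_(q < n) F p q * G p q).
Proof.
rewrite !mulr_sumr; apply: eq_bigr => p _; rewrite !mulr_sumr.
by apply: eq_bigr => q _; rewrite !mulrA.
Qed.

(** The leading coefficients are delta_ik delta_jl g^{pq}; the symbol is then
    multiplication by |xi|^2, and ellipticity holds with equality for the
    constant 1.  The other coefficients are chosen from [first_order]. *)
Lemma parabolic_lichnerowicz (R : realType) (n : nat) (T : topologicalType)
    (M : manifold R n T) (g : tensor_field M) : riemannian_metric g ->
  strictly_parabolic g (fun k a x => - lichnerowicz (g a) (k a) x).
Proof.
move=> rg; have gm := chart_metric rg.
have H a i j := lichnerowicz_symbol (gm a) i j.
pose B a i j := sval (cid (H a i j)).
pose C a i j := sval (cid (svalP (cid (H a i j)))).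
have HBC a i j := svalP (cid (svalP (cid (H a i j)))).
exists (fun a i j k l p q x => (i == k)%:R * ((j == l)%:R * gup (g a) x p q)), B, C.
split.
- move=> a i j k l; have oU := metric_open (gm a).
  have [sB sC _] := HBC a i j.
  split => [p q|p|]; [|exact: sB|exact: sC].
  by do 2 (apply: (smooth_mul oU); first exact: (smooth_cst oU));
    exact: smooth_gup (gm a) p q.
- move=> h [hs _ _] a x Ux i j; have [_ _ E] := HBC a i j.
  have hs' : smooth_field (chart_img (atlas a)) (h a) by move=> ? ?; exact: hs.
  have := E _ hs' _ Ux; rewrite -/(B a i j) -/(C a i j).
  move: (B a i j) (C a i j) => Bij Cij /eqP.
  have LE : - lichnerowicz (g a) (h a) x i j =
      (- lichnerowicz (g a) (h a) x) i j by rewrite [RHS]mxE.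
  rewrite subr_eq LE => /eqP.
  move=> ->.
  have S2 : \sum_(p < n) \sum_(q < n) gup (g a) x p q *
      partial p (partial q (fun y => h a y i j)) x =
    \sum_(k < n) \sum_(l < n) \sum_(p < n) \sum_(q < n)
      (i == k)%:R * ((j == l)%:R * gup (g a) x p q) *
        partial p (partial q (fun y => h a y k l)) x.
    apply: esym; rewrite -[RHS](sum_delta2 i j (fun k l =>
      \sum_(p < n) \sum_(q < n) gup (g a) x p q *
        partial p (partial q (fun y => h a y k l)) x)).
    by apply: eq_bigr => k _; apply: eq_bigr => l _; exact: sum_mul2.
  apply: etrans (congr1 (+%R _) S2) _.
  rewrite addrC -big_split; apply: eq_bigr => k _ /=.
  rewrite -big_split; apply: eq_bigr => l _ /=.
  by rewrite addrA.
- exists 1; first exact: ltr01.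
  move=> a x Ux xi eta _; cbv zeta; rewrite mul1r.
  set sigma := \matrix_(i, j) _.
  have -> : sigma = covector_sqnorm (g a) x xi *: eta.
    apply/matrixP => i j; rewrite [LHS]mxE [RHS]mxE mulrC.
    rewrite -[RHS](sum_delta2 i j (fun k l => eta k l * _)).
    apply: eq_bigr => k _; apply: eq_bigr => l _.
    have -> : covector_sqnorm (g a) x xi =
        \sum_(p < n) \sum_(q < n) gup (g a) x p q * (xi ord0 p * xi ord0 q).
      rewrite /covector_sqnorm mxE exchange_big; apply: eq_bigr => q _ /=.
      rewrite !mxE mulr_suml; apply: eq_bigr => p _.
      by rewrite mulrAC mulrC [xi _ _ * _]mulrC mulrA.
    rewrite [eta k l * _]mulrC mulrA mulrA -[(i == k)%:R * _ * _]mulrA.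
    rewrite -sum_mul2 mulr_suml; apply: eq_bigr => p _.
    by rewrite mulr_suml; apply: eq_bigr => q _; rewrite !mulrA.
  rewrite /tensor_inner mulr_sumr; apply: ler_sum => i _.
  rewrite mulr_sumr; apply: ler_sum => j _.
  by rewrite -scalemxAr -scalemxAl [X in _ <= X * _]mxE mulrA.
Qed.

Theorem mainTheorem6 (R : realType) (n : nat) (T : topologicalType)
    (M : manifold R n T) (g : tensor_field M) :
  compact [set: T] -> connected [set: T] -> riemannian_metric g ->
  (forall h : tensor_field M, sym2_tensor h -> chen_nagano g h ->
    forall a x, chart_img (atlas a) x ->
      derivable (fun s : R => ricci (fun y => g a y + s *: h a y) x) 0 1 /\
      ricci_lin (g a) (h a) x = 2^-1 *: lichnerowicz (g a) (h a) x)
  /\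
  (einstein g ->
    (forall (J : interval R) (h : R -> tensor_field M),
      (forall t, t \in J -> sym2_tensor (h t) /\ chen_nagano g (h t)) ->
      (evolves_by (fun k a x => - 2 *: ricci_lin (g a) (k a) x) J h <->
       evolves_by (fun k a x => - lichnerowicz (g a) (k a) x) J h)) /\
    strictly_parabolic g (fun k a x => - lichnerowicz (g a) (k a) x)).
Proof.
move=> _ _ rg; split=> [|_]; first exact: ricci_lin_lichnerowicz.
split=> [J h hJ|]; last exact: parabolic_lichnerowicz.
apply: eq_evolves_by => t tJ a x Ux; have [ht gauge] := hJ t tJ.
have [_ ->] := ricci_lin_lichnerowicz rg ht gauge Ux.
by rewrite scalerA mulNr mulfV ?pnatr_eq0 // scaleN1r.
Qed.
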